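(* Given $L\in\mathcal{L}$, let $A_1,\ldots,A_m$ be non-negative matrices that define operators on $L$. If $f\in\mathcal{A}_+$ and $\rho(A_1\cdots A_m)<R_f$, then $$\rho(f(A_1\circ\cdots\circ A_m))\le\rho(f(A_1\cdots A_m)).$$
   Context: Let $R$ be either $\{1,\ldots,n\}$ for some $n\in\mathbb{N}$ or $\mathbb{N}$, and let $S(R)$ be the vector lattice of all complex sequences $(x_i)_{i\in R}$. A Banach space $L\subseteq S(R)$ is a Banach sequence space if $x\in S(R)$, $y\in L$ and $|x|\le|y|$ (coordinatewise) imply $x\in L$ and $\|x\|_L\le\|y\|_L$. $\mathcal{L}$ is the collection of all Banach sequence spaces $L$ such that $e_i=\chi_{\{i\}}\in L$ and $\|e_i\|_L=1$ for all $i\in R$. A matrix $A=[a_{ij}]_{i,j\in R}$ (possibly infinite) is non-negative if $a_{ij}\ge0$ for all $i,j\in R$. A non-negative matrix $A$ defines an operator on $L$ if $Ax\in L$ for all $x\in L$, where $(Ax)_i=\sum_{j\in R}a_{ij}x_j$; this operator is automatically bounded, and $A$ is identified with it. $\rho(A)$ is the spectral radius; juxtaposition is the ordinary matrix product, and $A\circ B=[a_{ij}b_{ij}]_{i,j\in R}$ is the Hadamard product (which, for $L\in\mathcal{L}$, again defines an operator on $L$). $\mathcal{A}_+$ is the collection of all power series $f(z)=\sum_{j=0}^\infty\alpha_jz^j$ with coefficients $\alpha_j\ge0$ ($j=0,1,\ldots$). $R_f$ is the radius of convergence of $f$, i.e. $1/R_f=\limsup_{j\to\infty}\alpha_j^{1/j}$.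 If $A$ is a bounded operator on a Banach space with $\rho(A)<R_f$, then $f(A)=\sum_{j=0}^\infty\alpha_jA^j$. *)

(* Defs.v *)
From HB Require Import structures.
From mathcomp Require Import all_boot all_order all_algebra.
From mathcomp Require Import complex.
From mathcomp Require Import all_classical all_reals all_analysis.

Set Implicit Arguments.
Unset Strict Implicit.
Unset Printing Implicit Defensive.

Import Order.TTheory GRing.Theory Num.Theory.
Import numFieldNormedType.Exports.

Local Open Scope classical_set_scope.
Local Open Scope ring_scope.
Local Open Scope complex_scope.

(* [Initial n] stands for {1, ..., n + 1}, which is indexed by 'I_n.+1 (shifted
   to start from 0); in particular the index set is never empty. *)
Inductive index_set := Initial of nat | Naturals.

Definition index_type (J : index_set) : countType :=
  match J with Initial n => 'I_n.+1 | Naturals => nat end.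

Coercion index_type : index_set >-> countType.

Definition has_isum (K : numFieldType) (J : index_set) : (J -> K) -> K -> Prop :=
  match J with
  | Initial n => fun u s => \sum_(j < n.+1) u j = s
  | Naturals => fun u s => series u @ \oo --> s
  end.

(* The value is 0 when the series diverges. *)
Definition isum (K : numFieldType) (J : index_set) (u : J -> K) : K :=
  xget 0 [set s | has_isum u s].

(* A Banach space of sequences is a complex Banach space together with an
   injective linear map to the sequences indexed by J. *)
Record banach_seq_space (R : realType) (J : index_set) := BanachSeqSpace {
  bss_carrier :> completeNormedModType R[i];
  coords : bss_carrier -> J -> R[i];
  coords_linear : forall (a : R[i]) (x y : bss_carrier) (i : J),
    coords (a *: x + y) i = a * coords x i + coords y i;
  coords_inj : injective coords;
  coords_solid : forall (x : J -> R[i]) (y : bss_carrier),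
    (forall i, `|x i| <= `|coords y i|) ->
    exists2 z : bss_carrier, coords z = x & `|z| <= `|y| }.

(* Membership in the class of spaces called L in calligraphic type. *)
Definition normalized_bss (R : realType) (J : index_set)
    (L : banach_seq_space R J) : Prop :=
  forall i : J, exists2 e : L, coords e = (fun k => (k == i)%:R) & `|e| = 1.

Definition imatrix (R : realType) (J : index_set) := J -> J -> R.

Definition nonneg_imx (R : realType) (J : index_set) (A : imatrix R J) : Prop :=
  forall i j, 0 <= A i j.

Definition imx1 (R : realType) (J : index_set) : imatrix R J :=
  fun i j => (i == j)%:R.

Definition imulmx (R : realType) (J : index_set) (A B : imatrix R J) :
    imatrix R J :=
  fun i j => isum (fun k => A i k * B k j).

(* A_1 (A_2 (... (A_m I))) *)
Definition imx_prod (R : realType) (J : index_set) (m : nat)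
    (A : 'I_m -> imatrix R J) : imatrix R J :=
  \big[@imulmx R J/@imx1 R J]_(k < m) A k.

Definition imx_hadamard (R : realType) (J : index_set) (m : nat)
    (A : 'I_m -> imatrix R J) : imatrix R J :=
  fun i j => \prod_(k < m) A k i j.

Section Operators.
Variables (R : realType) (J : index_set) (L : banach_seq_space R J).

Definition is_imx_image (A : imatrix R J) (x y : L) : Prop :=
  forall i : J, has_isum (fun j => (A i j)%:C * coords x j) (coords y i).

Definition defines_operator (A : imatrix R J) : Prop :=
  forall x : L, exists y : L, is_imx_image A x y.

(* Meaningful when [defines_operator A]; the image is then unique since
   [coords] is injective. *)
Definition imx_op (A : imatrix R J) : L -> L :=
  fun x => xget 0 [set y | is_imx_image A x y].

End Operators.

Arguments imx_op {R J} L A x.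

Section SpectralRadius.
Variables (R : realType) (V : completeNormedModType R[i]).

Definition spectrum (T : V -> V) : set R[i] :=
  [set a | ~ exists S : {linear V -> V}, [/\ continuous S,
     (forall x, S (a *: x - T x) = x) & (forall x, a *: S x - T (S x) = x)]].

(* [`|a|] has type R[i]; its real part is the modulus as an element of R. *)
Definition spectral_radius (T : V -> V) : \bar R :=
  ereal_sup [set (complex.Re `|a|)%:E | a in spectrum T].

Definition cvg_op_norm (S : nat -> V -> V) (T : V -> V) : Prop :=
  forall e : R, 0 < e ->
    \forall n \near \oo, forall x, `|S n x - T x| <= e%:C * `|x|.

(* [alpha] is the sequence of coefficients of f, and the sum defining f(T) is
   taken in operator norm (with value 0 when it diverges). *)
Definition power_series_op (alpha : nat -> R) (T : V -> V) : V -> V :=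
  xget (fun=> 0)
    [set F | cvg_op_norm
               (fun n x => \sum_(j < n) (alpha j)%:C *: iter j T x) F].

End SpectralRadius.

(* In \bar R, 0^-1 = +oo and +oo^-1 = 0; the value of the sequence at j = 0 is
   irrelevant to the limit superior. *)
Definition convergence_radius (R : realType) (alpha : nat -> R) : \bar R :=
  ((limn_esup (fun j : nat => (alpha j `^ (j%:R^-1))%:E))^-1)%E.

(* Main.v *)
(* Growth rates replace complex analysis.  Say that [T] grows at rate [s] if
   [|T^k| <= c s^k] for some [c]; the Neumann series puts the spectrum in the disc
   of radius [s].  Conversely, for a positive operator the infimum [r] of the
   growth rates lies in the spectrum, so [r] is the spectral radius.

   Write [H] for the Hadamard product, [P = A_1 ... A_m], with indices read
   cyclically.  By [sum_l prod_k u_k(l) <= prod_k sum_l u_k(l)] the entries of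
   [H^n] are at most the product over [k] of those of
   [A_k A_(k+1) ... A_(k+n-1)].  Each of these [m] words, for [n = m q], is
   [P^(q-1)] up to a bounded prefix and suffix, and the entries of a matrix are
   at most its norm; hence every growth rate of [P] is one of [H].

   If [T] grows at rate [s] then [f(T)] grows at rate [f(s)], so that [f(H)]
   grows at all rates [f(s)], [s > r].  Finally, [f(P)] dominates the
   polynomials [p(P)], [p] a partial sum of [f], whose spectrum contains [p(r)];
   this gives [f(r) <= rho(f(P))]. *)

From HB Require Import structures.
Require Import Defs.
From mathcomp Require Import all_boot all_order all_algebra.
From mathcomp Require Import complex.
From mathcomp Require Import all_classical all_reals all_analysis.
From mathcomp Require Import ring lra.

Set Implicit Arguments.
Unset Strict Implicit.
Unset Printing Implicit Defensive.

Import Order.TTheory GRing.Theory Num.Theory.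
Import numFieldNormedType.Exports.

Local Open Scope classical_set_scope.
Local Open Scope ring_scope.
Local Open Scope complex_scope.

(** * Norms and limits with real values *)

Section Null.
Variable R : realType.
Implicit Types (u v : nat -> R) (c : R).

(** One-sided: this is limsup u <= 0, with no lower bound on [u]. An upper estimate is thus enough
    to transfer it, and for norms of differences it is convergence. *)
Definition null u := forall e, 0 < e -> exists N, forall n, (N <= n)%N -> u n <= e.

Lemma null_le u v : (forall n, v n <= u n) -> null u -> null v.
Proof.
move=> le_vu u0 e e0; have [N uN] := u0 e e0; exists N => n /uN.
exact: le_trans (le_vu n).
Qed.

Lemma null_shift u k : null u -> null (fun n => u (n + k)%N).
Proof.
move=> u0 e /u0[N uN]; exists N => n nN; apply: uN.
by rewrite (leq_trans nN) // leq_addr.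
Qed.

Lemma null_add u v : null u -> null v -> null (fun n => u n + v n).
Proof.
move=> u0 v0 e e0; have e20 : 0 < e / 2 by lra.
have [N uN] := u0 _ e20; have [M vM] := v0 _ e20.
exists (maxn N M) => n; rewrite geq_max => /andP[/uN un /vM vn]; lra.
Qed.

Lemma null_scale u c : 0 <= c -> null u -> null (fun n => c * u n).
Proof.
move=> c0 u0 e e0; have c10 : 0 < c + 1 by lra.
have [|N uN] := u0 (e / (c + 1)); first by rewrite divr_gt0.
exists N => n /uN un; case: (ltP (u n) 0) => [un0|un0].
  by rewrite (le_trans _ (ltW e0)) // mulr_ge0_le0 // ltW.
have : (c + 1) * u n <= e by rewrite mulrC -ler_pdivlMr.
nra.
Qed.

Lemma null_const_le0 c u : (forall n, c <= u n) -> null u -> c <= 0.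
Proof.
move=> cu u0; rewrite leNgt; apply/negP => c0.
have [|N uN] := u0 (c / 2); first lra.
by have := cu N; have := uN N (leqnn N); lra.
Qed.

Lemma null_geometric c q : 0 <= q < 1 -> null (fun n => c * q ^+ n).
Proof.
move=> /andP[q0 q1].
have qn0 : q ^+ n @[n --> \oo] --> 0.
  by apply: cvg_expr; rewrite ger0_norm.
have: null (fun n => q ^+ n).
  move=> e e0; have /cvgrPdist_le /(_ e e0)[N _ HN] := qn0.
  by exists N => n /HN /=; rewrite sub0r normrN ger0_norm // exprn_ge0.
move/(null_scale (normr_ge0 c)); apply: null_le => n.
by rewrite ler_wpM2r ?exprn_ge0 ?ler_norm.
Qed.

Lemma nondecreasing_bounded_null u c :
  {homo u : m n / (m <= n)%N >-> m <= n} -> (forall n, u n <= c) ->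
  exists2 l, null (fun n => l - u n) & (forall n, u n <= l) /\ l <= c.
Proof.
move=> u_nd u_c; pose A := range u; exists (sup A); last first.
  split=> [n|]; last by apply: ge_sup; [exists (u 0%N), 0%N | move=> _ [n _ <-]].
  by apply: ub_le_sup; [exists c => _ [k _ <-] | exists n].
move=> e e0; have supA : has_sup A.
  by split; [exists (u 0%N), 0%N | exists c => _ [n _ <-]].
have [_ [N _ <-] uN] := sup_adherent e0 supA; exists N => n /u_nd uNn; lra.
Qed.

Lemma geometric_sum_le c q n : 0 <= c -> 0 <= q < 1 ->
  \sum_(j < n) c * q ^+ j <= c / (1 - q).
Proof.
move=> c0 /andP[q0 q1]; rewrite -mulr_sumr ler_wpM2l //.
have q10 : 0 < 1 - q by lra.
rewrite -[leRHS]mul1r ler_pdivlMr //.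
have -> : (\sum_(j < n) q ^+ j) * (1 - q) = 1 - q ^+ n.
  by rewrite mulrC -[RHS]opprB subrX1 -mulNr opprB.
by rewrite gerBl exprn_ge0.
Qed.

End Null.

Section RealNorm.
Variable R : realType.

Definition nrm (V : normedZmodType R[i]) (x : V) : R := complex.Re `|x|.

Section Zmodule.
Variable V : normedZmodType R[i].
Implicit Types x y : V.

Lemma normE x : `|x| = (nrm x)%:C.
Proof. by rewrite /nrm RRe_real // normr_real. Qed.

Lemma nrm_ge0 x : 0 <= nrm x.
Proof. by rewrite -ler0c -normE. Qed.

Lemma nrm0 : nrm (0 : V) = 0.
Proof. by rewrite /nrm normr0. Qed.

Lemma nrmD x y : nrm (x + y) <= nrm x + nrm y.
Proof. by rewrite -lecR rmorphD /= -!normE ler_normD. Qed.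

Lemma nrmN x : nrm (- x) = nrm x.
Proof. by rewrite /nrm normrN. Qed.

Lemma nrmB x y : nrm (x - y) <= nrm x + nrm y.
Proof. by rewrite -(nrmN y) nrmD. Qed.

Lemma nrm_distC x y : nrm (x - y) = nrm (y - x).
Proof. by rewrite -opprB nrmN. Qed.

Lemma nrm_dist_triangle z x y : nrm (x - y) <= nrm (x - z) + nrm (z - y).
Proof. by rewrite -[x - y](subrKA z) nrmD. Qed.

Lemma nrm_le0 x : nrm x <= 0 -> x = 0.
Proof.
move=> x0; apply/eqP; rewrite -normr_eq0 normE.
by rewrite (@le_anti _ _ (nrm x) 0) // x0 nrm_ge0.
Qed.

Lemma nrm_sum (I : Type) (r : seq I) (F : I -> V) :
  nrm (\sum_(i <- r) F i) <= \sum_(i <- r) nrm (F i).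
Proof.
elim: r => [|i r IHr]; first by rewrite !big_nil nrm0.
by rewrite !big_cons; apply: le_trans (nrmD _ _) _; rewrite lerD2l.
Qed.

Definition lim_to (u : nat -> V) x := null (fun n => nrm (u n - x)).

Lemma lim_to_unique u x y : lim_to u x -> lim_to u y -> x = y.
Proof.
move=> ux uy; apply/eqP; rewrite -subr_eq0; apply/eqP/nrm_le0.
apply: null_const_le0 (null_add ux uy) => n.
by rewrite (nrm_distC (u n) x) nrm_dist_triangle.
Qed.

Lemma lim_to_const x : lim_to (fun=> x) x.
Proof. by move=> e e0; exists 0%N => n _; rewrite subrr nrm0 ltW. Qed.

Lemma lim_to_shift u x k : lim_to u x -> lim_to (fun n => u (n + k)%N) x.
Proof. exact: (@null_shift _ (fun n => nrm (u n - x))). Qed.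

Lemma lim_to_add u v x y :
  lim_to u x -> lim_to v y -> lim_to (fun n => u n + v n) (x + y).
Proof.
move=> ux vy; apply: null_le (null_add ux vy) => n.
by rewrite opprD addrACA nrmD.
Qed.

Lemma lim_to_opp u x : lim_to u x -> lim_to (fun n => - u n) (- x).
Proof. by move=> ux; apply: null_le ux => n; rewrite -opprD nrmN. Qed.

Lemma lim_to_sum (I : Type) (r : seq I) (u : I -> nat -> V) (x : I -> V) :
  (forall i, lim_to (u i) (x i)) ->
  lim_to (fun n => \sum_(i <- r) u i n) (\sum_(i <- r) x i).
Proof.
move=> ux; elim: r => [|i r IHr].
  by rewrite big_nil; under eq_fun do rewrite big_nil; exact: lim_to_const.
rewrite big_cons; under eq_fun do rewrite big_cons.
exact: lim_to_add.
Qed.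

Lemma nrm_lim_le u x c : lim_to u x -> (forall n, nrm (u n) <= c) -> nrm x <= c.
Proof.
move=> ux uc; rewrite -subr_le0; apply: null_const_le0 ux => n.
by have := nrm_dist_triangle (u n) x 0; rewrite !subr0 nrm_distC; have := uc n; lra.
Qed.

End Zmodule.

Lemma nrm_le (V W : normedZmodType R[i]) (x : V) (y : W) :
  (`|x| <= `|y|) = (nrm x <= nrm y).
Proof. by rewrite !normE lecR. Qed.

Lemma nrmZ (V : normedModType R[i]) (a : R[i]) (x : V) :
  nrm (a *: x) = nrm a * nrm x.
Proof. by apply: complexI; rewrite rmorphM /= -!normE normrZ. Qed.

Lemma nrmM (a b : R[i]) : nrm (a * b) = nrm a * nrm b.
Proof. by apply: complexI; rewrite rmorphM /= -!normE normrM. Qed.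

Lemma nrm_real (a : R) : nrm (a%:C) = `|a|.
Proof. by rewrite /nrm normc_def /= expr0n addr0 sqrtr_sqr. Qed.

Lemma nrm_realZ (V : normedModType R[i]) (a : R) (x : V) :
  0 <= a -> nrm (a%:C *: x) = a * nrm x.
Proof. by move=> a0; rewrite nrmZ nrm_real ger0_norm. Qed.

Lemma nrm1 : nrm (1 : R[i]) = 1.
Proof. by rewrite -(rmorph1 (real_complex R)) nrm_real normr1. Qed.

Lemma nrmV (a : R[i]) : nrm a^-1 = (nrm a)^-1.
Proof. by apply: complexI; rewrite -normE normfV normE fmorphV. Qed.

Lemma Re_le_nrm (a : R[i]) : `|complex.Re a| <= nrm a.
Proof. by rewrite -lecR -normE normc_ge_Re. Qed.

Lemma Im_le_nrm (a : R[i]) : `|complex.Im a| <= nrm a.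
Proof. by rewrite /nrm normc_def /= -sqrtr_sqr ler_wsqrtr // lerDr sqr_ge0. Qed.

(** In the order of [R[i]] the hypothesis forces each [v n] to be real, so the imaginary part of [d]
    has to be shown to vanish too. *)
Lemma lim_norm_le (u v : nat -> R[i]) c d : (forall n, `|u n| <= v n) ->
  lim_to u c -> lim_to v d -> `|c| <= d.
Proof.
move=> uv uc vd.
have uvn n : complex.Im (v n) = 0 /\ nrm (u n) <= complex.Re (v n).
  by have := uv n; rewrite normE lecE => /andP[/eqP].
rewrite normE lecE /=; apply/andP; split.
  rewrite -normr_le0; apply: null_const_le0 vd => n.
  by have := Im_le_nrm (v n - d); rewrite raddfB /= (uvn n).1 sub0r normrN.
rewrite -subr_le0; apply: null_const_le0 (null_add uc vd) => n.
have := nrm_dist_triangle (u n) c 0; rewrite !subr0 nrm_distC.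
have := le_trans (ler_norm _) (Re_le_nrm (v n - d)).
by rewrite raddfB /=; have := (uvn n).2; lra.
Qed.

Lemma lim_to_real (v : nat -> R) c : lim_to (fun n => (v n)%:C) c -> c = (complex.Re c)%:C.
Proof.
move=> vc; suff : complex.Im c = 0 by case: c {vc} => a b /= ->.
apply/eqP; rewrite -normr_le0; apply: null_const_le0 vc => n.
by have := Im_le_nrm ((v n)%:C - c); rewrite raddfB /= sub0r normrN.
Qed.

Lemma lim_to_scale (V : normedModType R[i]) (a : R[i]) (u : nat -> V) x :
  lim_to u x -> lim_to (fun n => a *: u n) (a *: x).
Proof.
move=> /(null_scale (nrm_ge0 a)); apply: null_le => n.
by rewrite -scalerBr nrmZ.
Qed.

Lemma complex_gt0 (e : R[i]) : 0 < e -> 0 < complex.Re e /\ e = (complex.Re e)%:C.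
Proof. by case: e => a b; rewrite ltcE /= => /andP[/eqP-> a0]. Qed.

Lemma complete_lim (V : completeNormedModType R[i]) (u : nat -> V) :
  (forall e, 0 < e -> exists N, forall m n, (N <= m)%N -> (m <= n)%N ->
     nrm (u n - u m) <= e) ->
  exists x, lim_to u x.
Proof.
move=> u_cauchy.
have /cauchy_cvgP : cauchy (u @ \oo).
  apply/cauchy_ballP => ce /complex_gt0[]; set e := complex.Re ce => e0 ->.
  (* Balls are open: two distances to [u N] of at most e / 4 add up to strictly less than e. *)
  have e20 : 0 < e / 4 by rewrite divr_gt0.
  have [N HN] := u_cauchy _ e20.
  have uN n : (N <= n)%N -> nrm (u n - u N) <= e / 4 by exact: HN.
  exists ([set u n | n in [set n | (N <= n)%N]],
          [set u n | n in [set n | (N <= n)%N]]) => /=.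
    by split; exists N => // n /= Nn; exists n.
  case=> x y /= [[m /= Nm <-] [n /= Nn <-]].
  rewrite -ball_normE /ball_ /= normE ltcR.
  have := nrm_dist_triangle (u N) (u m) (u n).
  by rewrite (nrm_distC (u N)); have := uN _ Nm; have := uN _ Nn; lra.
move=> /cvg_ex[x ux]; exists x => e e0.
have e0C : 0 < e%:C :> R[i] by rewrite ltcR.
have /cvgrPdist_le /(_ _ e0C)[N _ HN] := ux.
by exists N => n /HN /=; rewrite normE lecR nrm_distC.
Qed.

(** Weierstrass test: the partial sums of [b] increase to some [l], and their gap to [l] bounds all
    later increments of the partial sums of [u]. *)
Lemma series_lim (V : completeNormedModType R[i]) (u : nat -> V)
    (b : nat -> R) (c : R) :
  (forall n, nrm (u n) <= b n) -> (forall n, \sum_(j < n) b j <= c) ->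
  exists x, lim_to (fun n => \sum_(j < n) u j) x.
Proof.
move=> ub b_c; have b0 n : 0 <= b n by apply: le_trans (ub n); exact: nrm_ge0.
have sumB (W : zmodType) (f : nat -> W) m n : (m <= n)%N ->
    \sum_(j < n) f j - \sum_(j < m) f j = \sum_(m <= j < n) f j.
  move=> mn; rewrite -!(big_mkord xpredT f) (big_cat_nat (n := m)) //=.
  by rewrite addrAC subrr add0r.
have sum_nd : {homo (fun n => \sum_(j < n) b j) : m n / (m <= n)%N >-> m <= n}.
  by move=> m n mn; rewrite -subr_ge0 sumB // sumr_ge0.
have [l bl [bl_le _]] := nondecreasing_bounded_null sum_nd b_c.
apply: complete_lim => e /bl[N HN]; exists N => m n Nm mn.
apply: le_trans (HN m Nm); apply: (@le_trans _ _ (\sum_(j < n) b j - \sum_(j < m) b j)).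
  rewrite !sumB //; apply: le_trans (nrm_sum _ _) _.
  exact: ler_sum.
by rewrite lerB.
Qed.

End RealNorm.

(** * Growth rates, power series and resolvents *)

Section Operators.
Variables (R : realType) (V : completeNormedModType R[i]).
Implicit Types (T S : V -> V) (s c : R) (x y : V) (alpha : nat -> R).

Definition bdd T := exists c, forall x, nrm (T x) <= c * nrm x.

(** For a bounded linear [T], the infimum of the rates [s >= 0] is Gelfand's limit of |T^k|^(1/k);
    this form needs neither roots nor an operator norm. *)
Definition growth T s := exists c, forall k x, nrm (iter k T x) <= c * s ^+ k * nrm x.

Definition resolvent T (a : R[i]) := exists S : {linear V -> V},
  [/\ bdd S, forall x, S (a *: x - T x) = x & forall x, a *: S x - T (S x) = x].

Definition psum alpha T n x := \sum_(j < n) (alpha j)%:C *: iter j T x.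

Lemma bdd_ge c0 T : bdd T -> exists2 c, c0 <= c & forall x, nrm (T x) <= c * nrm x.
Proof.
move=> [c Tc]; exists (Num.max c0 c); first by rewrite le_max lexx.
by move=> x; apply: le_trans (Tc x) _; rewrite ler_wpM2r ?nrm_ge0 // le_max lexx orbT.
Qed.

Lemma growth_gt0 T s : 0 <= s -> growth T s ->
  exists2 c, 0 < c & forall k x, nrm (iter k T x) <= c * s ^+ k * nrm x.
Proof.
move=> s0 [c Tc]; exists (`|c| + 1); first by rewrite ltr_wpDl.
move=> k x; apply: le_trans (Tc k x) _.
rewrite ler_wpM2r ?nrm_ge0 // ler_wpM2r ?exprn_ge0 //.
by rewrite (le_trans (ler_norm c)) // lerDl.
Qed.

Lemma growth_le T s t : 0 <= s -> s <= t -> growth T s -> growth T t.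
Proof.
move=> s0 st /(growth_gt0 s0)[c c0 Tc]; exists c => k x; apply: le_trans (Tc k x) _.
by rewrite ler_wpM2r ?nrm_ge0 // ler_wpM2l ?(ltW c0) // lerXn2r // nnegrE (le_trans s0).
Qed.

Lemma bdd_iter T c : 0 <= c -> (forall x, nrm (T x) <= c * nrm x) ->
  forall k x, nrm (iter k T x) <= c ^+ k * nrm x.
Proof.
move=> c0 Tc; elim=> [|k IHk] x; first by rewrite expr0 mul1r.
by rewrite iterS exprS -mulrA; apply: le_trans (Tc _) _; rewrite ler_wpM2l.
Qed.

Lemma bdd_growth T : bdd T -> exists2 s, 0 <= s & growth T s.
Proof.
move=> /(bdd_ge 0)[c c0 Tc]; exists c => //; exists 1 => k x.
by rewrite mul1r bdd_iter.
Qed.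

Lemma growth_bdd T s : growth T s -> bdd T.
Proof. by move=> [c Tc]; exists (c * s) => x; have := Tc 1%N x; rewrite expr1. Qed.

Lemma bdd_comp T S : bdd T -> bdd S -> bdd (T \o S).
Proof.
move=> /(bdd_ge 0)[c c0 Tc] [d Sd]; exists (c * d) => x /=.
by apply: le_trans (Tc _) _; rewrite -mulrA ler_wpM2l.
Qed.

Lemma bdd_add T S : bdd T -> bdd S -> bdd (fun x => T x + S x).
Proof.
move=> [c Tc] [d Sd]; exists (c + d) => x; rewrite mulrDl.
by apply: le_trans (nrmD _ _) _; rewrite lerD.
Qed.

Lemma bdd_scale a T : bdd T -> bdd (fun x => a *: T x).
Proof.
by move=> [c Tc]; exists (nrm a * c) => x; rewrite nrmZ -mulrA ler_wpM2l ?nrm_ge0.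
Qed.

Lemma bdd_id : bdd idfun.
Proof. by exists 1 => x; rewrite mul1r. Qed.

(** Operators obtained from [xget] or from choice are bare functions; this gives them their linear
    structure. *)
Lemma linear_bundle T : linear T -> exists S : {linear V -> V}, T = S.
Proof.
move=> T_lin; pose S : {linear V -> V} := HB.pack T (GRing.isLinear.Build _ _ _ _ T T_lin).
by exists S.
Qed.

Lemma bdd_continuous (S : {linear V -> V}) : bdd S <-> continuous S.
Proof.
split=> [/(bdd_ge 0)[c c0 Sc]|/(_ 0)/continuous_linear_bounded/linear_boundedP].
  apply/linear_bounded_continuous/linear_boundedP; exists c%:C; split.
    by rewrite ger0_real // ler0c.
  move=> r cr x; apply: le_trans (_ : c%:C * `|x| <= _); last first.
    by rewrite ler_wpM2r // ltW.
  by rewrite !normE -rmorphM lecR.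
move=> /pinfty_ex_gt0[r r0 Sr]; exists (complex.Re r) => x.
have [_ rE] := complex_gt0 r0.
by rewrite -lecR rmorphM /= -rE -!normE.
Qed.

Lemma spectrumP T a : spectrum T a <-> ~ resolvent T a.
Proof.
by split=> + [S [S1 S2 S3]]; apply; exists S; split=> //; apply/bdd_continuous.
Qed.

Lemma lim_to_bdd (T : {linear V -> V}) (u : nat -> V) x :
  bdd T -> lim_to u x -> lim_to (fun n => T (u n)) (T x).
Proof.
move=> /(bdd_ge 0)[c c0 Tc] /(null_scale c0) ux; apply: null_le ux => n.
by rewrite -linearB.
Qed.

Lemma iter_linear (T : {linear V -> V}) k : linear (iter k T).
Proof. by elim: k => [|k IHk] a x y //=; rewrite IHk linearP. Qed.

Lemma psum_linear alpha (T : {linear V -> V}) n : linear (psum alpha T n).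
Proof.
move=> a x y; rewrite /psum scaler_sumr -big_split /=; apply: eq_bigr => j _.
by rewrite iter_linear scalerDr !scalerA mulrC.
Qed.

Lemma psumSr alpha T n x :
  psum alpha T n.+1 x = psum alpha T n x + (alpha n)%:C *: iter n T x.
Proof. by rewrite /psum big_ord_recr. Qed.

Lemma psum_comm alpha (T : {linear V -> V}) n x : psum alpha T n (T x) = T (psum alpha T n x).
Proof.
by rewrite /psum linear_sum; apply: eq_bigr => j _; rewrite linearZ -iterSr.
Qed.

Lemma psum_bound alpha T s M B x n : (forall j, 0 <= alpha j) -> 0 <= M ->
  (forall n, \sum_(j < n) alpha j * s ^+ j <= B) ->
  (forall k, nrm (iter k T x) <= M * s ^+ k) -> nrm (psum alpha T n x) <= M * B.
Proof.
move=> alpha0 M0 sumB Tx; apply: le_trans (nrm_sum _ _) _.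
apply: le_trans (ler_wpM2l M0 (sumB n)); rewrite mulr_sumr; apply: ler_sum => j _.
by rewrite nrm_realZ // mulrCA ler_wpM2l.
Qed.

(** The terms at x are at most c |x| alpha_j s^j with one c for all x. So the pointwise limits
    exist, and the tails are small relative to |x| uniformly in x, as [cvg_op_norm] demands. *)
Lemma power_series_exists (T : {linear V -> V}) alpha s B :
  (forall j, 0 <= alpha j) -> 0 <= s -> growth T s ->
  (forall n, \sum_(j < n) alpha j * s ^+ j <= B) ->
  exists F : {linear V -> V}, (forall x, lim_to (psum alpha T ^~ x) (F x)) /\
    forall e, 0 < e -> exists N, forall n, (N <= n)%N ->
      forall x, nrm (psum alpha T n x - F x) <= e * nrm x.
Proof.
move=> alpha0 s0 /(growth_gt0 s0)[c c0 Tc] sumB.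
have as0 j : 0 <= alpha j * s ^+ j by rewrite mulr_ge0 ?exprn_ge0.
have Tx j x : nrm ((alpha j)%:C *: iter j T x) <= c * nrm x * (alpha j * s ^+ j).
  have -> : c * nrm x * (alpha j * s ^+ j) = alpha j * (c * s ^+ j * nrm x) by ring.
  by rewrite nrm_realZ // ler_wpM2l.
have sum_nd : {homo (fun n => \sum_(j < n) alpha j * s ^+ j) : m n / (m <= n)%N >-> m <= n}.
  by apply/nondecreasing_seqP => n; rewrite big_ord_recr lerDl.
have [a a_lim [a_ge _]] := nondecreasing_bounded_null sum_nd sumB.
have /choice[F FE] : forall x, exists y, lim_to (psum alpha T ^~ x) y.
  move=> x; apply: (@series_lim _ _ (fun j => (alpha j)%:C *: iter j T x) _ _ (Tx^~ x)) => //.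
  by move=> n; rewrite -mulr_sumr; apply: ler_wpM2l (sumB n); rewrite mulr_ge0 ?nrm_ge0 // ltW.
have F_lin : linear F.
  move=> b x y; apply: lim_to_unique (FE _) _.
  under eq_fun do rewrite psum_linear.
  exact: lim_to_add (lim_to_scale _ (FE x)) (FE y).
have [F' F'E] := linear_bundle F_lin; rewrite {}F'E in FE; exists F'; split=> // e e0.
have [|N aN] := a_lim (e / c); first by rewrite divr_gt0.
exists N => n Nn x; rewrite nrm_distC.
have tail m : nrm (psum alpha T (m + n) x - psum alpha T n x) <= e * nrm x.
  have -> : e * nrm x = c * nrm x * (e / c) by field; rewrite gt_eqF.
  apply: (@le_trans _ _ (c * nrm x * (a - \sum_(j < n) alpha j * s ^+ j))); last first.
    by rewrite ler_wpM2l ?aN // mulr_ge0 ?nrm_ge0 // ltW.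
  apply: (@le_trans _ _ (c * nrm x *
      (\sum_(j < m + n) alpha j * s ^+ j - \sum_(j < n) alpha j * s ^+ j))); last first.
    by rewrite ler_wpM2l ?lerB // mulr_ge0 ?nrm_ge0 // ltW.
  elim: m => [|m IHm]; first by rewrite !subrr mulr0 nrm0.
  rewrite addSn psumSr big_ord_recr /= addrAC [_ + _ - \sum_(j < n) _]addrAC mulrDr.
  by apply: le_trans (nrmD _ _) _; rewrite lerD // Tx.
apply: nrm_lim_le tail; apply: lim_to_add (lim_to_const _).
exact: (@lim_to_shift _ _ (psum alpha T ^~ x)).
Qed.

(** Convergence in operator norm implies pointwise convergence, so [xget] has only one candidate. *)
Lemma power_series_opE (T : {linear V -> V}) alpha (F : V -> V) :
  (forall e, 0 < e -> exists N, forall n, (N <= n)%N ->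
      forall x, nrm (psum alpha T n x - F x) <= e * nrm x) ->
  power_series_op alpha T = F.
Proof.
move=> FE; apply: xget_unique.
  move=> e /FE[N HN]; exists N => // n /= Nn x.
  by rewrite !normE -rmorphM lecR HN.
have limF (G : V -> V) : cvg_op_norm (psum alpha T) G -> forall x, lim_to (psum alpha T ^~ x) (G x).
  move=> GE x e e0.
  have [|N _ HN] := GE (e / (nrm x + 1)).
    by rewrite divr_gt0 // ltr_wpDl ?nrm_ge0.
  exists N => n /HN /= /(_ x); rewrite !normE -rmorphM lecR => /le_trans; apply.
  have x1 : 0 < nrm x + 1 by rewrite ltr_wpDl ?nrm_ge0.
  by rewrite mulrAC ler_pdivrMr // ler_wpM2l ?(ltW e0) // lerDl.
move=> G GE; apply/funext => x; apply: lim_to_unique (limF _ GE x) _.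
apply: limF => e /FE[N HN]; exists N => // n /= Nn y.
by rewrite !normE -rmorphM lecR HN.
Qed.

(* In the norm [sup_k |T^k x| / s^k], which is equivalent to the given one, T
   has norm at most s and so f(T) has norm at most f(s). *)
Lemma power_series_growth (T F : {linear V -> V}) alpha s B :
  (forall j, 0 <= alpha j) -> 0 <= s -> growth T s ->
  (forall n, \sum_(j < n) alpha j * s ^+ j <= B) ->
  (forall x, lim_to (psum alpha T ^~ x) (F x)) -> growth F B.
Proof.
move=> alpha0 s0 Ts sumB FE; have T_bdd := growth_bdd Ts.
have [c c0 Tc] := growth_gt0 s0 Ts; exists c => n x.
have B0 : 0 <= B by have := sumB 0%N; rewrite big_ord0.
(* The estimate for all [k] at once bounds F^n x in the equivalent norm, which makes the induction
   on [n] work; k = 0 is the claim. *)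
suff H k : nrm (iter k T (iter n F x)) <= c * B ^+ n * nrm x * s ^+ k.
  by have := H 0%N; rewrite expr0 mulr1.
elim: n k => [|n IHn] k; first by rewrite expr0 mulr1 mulrAC.
have iterT_comm j y : iter j T (F y) = F (iter j T y).
  elim: j => //= j ->; apply: lim_to_unique (lim_to_bdd T_bdd (FE _)) _.
  by under eq_fun do rewrite -psum_comm; exact: FE.
rewrite iterS iterT_comm; apply: nrm_lim_le (FE _) _ => m.
have -> : c * B ^+ n.+1 * nrm x * s ^+ k = c * B ^+ n * nrm x * s ^+ k * B.
  by rewrite exprS; ring.
apply: psum_bound sumB _ => // [|j].
  by rewrite !mulr_ge0 ?exprn_ge0 ?nrm_ge0 // ltW.
by rewrite -iterD -mulrA -exprD addnC.
Qed.

(** The partial sums telescope: (1 - T)(1 + ... + T^(n-1)) = 1 - T^n, and T^n tends to 0. This gives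
    a right inverse of 1 - T, which is also a left one since it commutes with T. *)
Lemma neumann_series (T : {linear V -> V}) q : 0 <= q < 1 -> growth T q ->
  exists F : {linear V -> V}, [/\ forall x, lim_to (psum (fun=> 1) T ^~ x) (F x),
    bdd F, forall x, F x - T (F x) = x & forall x, F (x - T x) = x].
Proof.
move=> q01 Tq; have /andP[q0 q1] := q01.
have sumB n : \sum_(j < n) 1 * q ^+ j <= 1 / (1 - q) by exact: geometric_sum_le.
have [F [FE _]] := power_series_exists (fun=> ler01) q0 Tq sumB.
have F_bdd : bdd F by apply: growth_bdd (power_series_growth _ q0 Tq sumB FE).
have T_bdd := growth_bdd Tq.
have psum_tele x n : psum (fun=> 1) T n x - T (psum (fun=> 1) T n x) = x - iter n T x.
  elim: n => [|n IHn]; first by rewrite /psum big_ord0 linear0 subr0 subrr.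
  by rewrite psumSr scale1r linearD opprD addrACA IHn addrA subrK.
have FT x : F x - T (F x) = x.
  apply: (@lim_to_unique _ _ (fun n => psum (fun=> 1) T n x - T (psum (fun=> 1) T n x))).
    exact: lim_to_add (FE x) (lim_to_opp (lim_to_bdd T_bdd (FE x))).
  under eq_fun do rewrite psum_tele.
  have [c Tc] := Tq; apply: null_le (null_geometric (c * nrm x) q01) => n.
  by rewrite addrAC subrr add0r nrmN mulrAC.
exists F; split=> // x; rewrite -[RHS]FT linearB; congr (_ - _).
apply: lim_to_unique (FE _) _; under eq_fun do rewrite psum_comm.
exact: lim_to_bdd.
Qed.

(** From a - T = a (1 - T / a), where T / a grows at rate s / |a| < 1. The approximating sums stay
    in the statement because for a > 0 they transmit positivity from [T] to the resolvent. *)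
Lemma resolvent_series (T : {linear V -> V}) s a :
  0 <= s -> growth T s -> s < nrm a ->
  exists F : {linear V -> V}, [/\ bdd F,
    forall x, lim_to (fun n => a^-1 *: psum (fun=> 1) (a^-1 \*: T) n x) (F x),
    forall x, F (a *: x - T x) = x & forall x, a *: F x - T (F x) = x].
Proof.
move=> s0 [c Tc] sa; have a0 : 0 < nrm a by exact: le_lt_trans sa.
have an0 : a != 0 by apply/eqP => E; rewrite E nrm0 ltxx in a0.
have iterZ k x : iter k (a^-1 \*: T) x = a^-1 ^+ k *: iter k T x.
  elim: k => [|k IHk]; first by rewrite expr0 scale1r.
  by rewrite iterS IHk /= linearZ scalerA -exprS.
have [||F [F_lim F_bdd F1 F2]] := @neumann_series (a^-1 \*: T) (s / nrm a).
- by rewrite divr_ge0 ?(ltW a0) //= ltr_pdivrMr // mul1r.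
- exists c => k x; rewrite iterZ nrmZ.
  have -> : nrm (a^-1 ^+ k) = (nrm a)^-1 ^+ k.
    by elim: k => [|k IHk]; rewrite ?expr0 ?nrm1 // !exprS nrmM IHk nrmV.
  rewrite expr_div_n -exprVn [c * _]mulrA [c * _ * _]mulrC -mulrA ler_wpM2l //.
  by rewrite exprn_ge0 // invr_ge0 ltW.
exists (a^-1 \*: F); split=> [|x|x|x].
- exact: bdd_scale.
- exact: lim_to_scale.
- have E : a^-1 *: (a *: x - T x) = x - (a^-1 \*: T) x.
    by rewrite scalerBr scalerA mulVf // scale1r.
  by rewrite -[RHS]F2 -E linearZ.
- by rewrite /= scalerA mulfV // scale1r linearZZ; exact: F1.
Qed.

Lemma resolvent_growth (T : {linear V -> V}) s a :
  0 <= s -> growth T s -> s < nrm a -> resolvent T a.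
Proof.
by move=> s0 Ts sa; have [F [? _ ? ?]] := resolvent_series s0 Ts sa; exists F.
Qed.

Lemma spectral_radius_le (T : {linear V -> V}) r :
  0 <= r -> (forall s, r < s -> growth T s) -> (spectral_radius T <= r%:E)%E.
Proof.
move=> r0 Ts; apply: ge_ereal_sup => _ [a /spectrumP a_spec <-].
rewrite lee_fin leNgt; apply/negP => ra; apply: a_spec.
by apply: (@resolvent_growth T ((r + nrm a) / 2)); rewrite /nrm; [|apply: Ts|]; lra.
Qed.

Lemma spectral_radius_ge (T : {linear V -> V}) r :
  0 <= r -> ~ resolvent T r%:C -> (r%:E <= spectral_radius T)%E.
Proof.
move=> r0 Tr; apply: ereal_sup_ubound; exists r%:C; first exact/spectrumP.
by rewrite -/(nrm _) nrm_real ger0_norm.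
Qed.

End Operators.

(** * Spectra of polynomials in an operator *)

Section PolynomialSpectrum.
Variables (R : realType) (V : completeNormedModType R[i]).
Implicit Types (alpha : nat -> R).

(** The quotient is g_n = sum_(j < n) r^(n-1-j) T^j, built by g_(n+1) = r^n + T g_n. *)
Lemma sub_iter_factor (T : {linear V -> V}) (r : R) n : bdd T ->
  exists g : {linear V -> V}, [/\ bdd g, forall x, g (T x) = T (g x) &
    forall x, (r ^+ n)%:C *: x - iter n T x = r%:C *: g x - T (g x)].
Proof.
move=> T_bdd; elim: n => [|n [g [g_bdd gT gE]]].
  exists (0%:C \*: idfun); split=> [|x|x].
  - exact: bdd_scale (@bdd_id _ _).
  - by rewrite /= !scale0r linear0.
  - by rewrite /= expr0 !scale1r !scale0r !linear0 !subrr addr0.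
exists ((r ^+ n)%:C \*: idfun \+ (T \o g)); split=> [|x|x].
- by apply: bdd_add; [apply: bdd_scale; exact: bdd_id | exact: bdd_comp].
- by rewrite /= gT (linearD T) (linearZZ T).
- have := congr1 T (gE x); rewrite !linearB !linearZZ /= => E.
  rewrite /= (linearD T) (linearZZ T) scalerDr scalerA -rmorphM -exprS opprD addrACA -E.
  by rewrite addrA subrK.
Qed.

Lemma sub_psum_factor (T : {linear V -> V}) (r : R) alpha n : bdd T ->
  exists g : {linear V -> V}, [/\ bdd g, forall x, g (T x) = T (g x) &
    forall x, (\sum_(j < n) alpha j * r ^+ j)%:C *: x - psum alpha T n x =
      r%:C *: g x - T (g x)].
Proof.
move=> T_bdd; elim: n => [|n [g [g_bdd gT gE]]].
  exists (0%:C \*: idfun); split=> [|x|x].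
  - exact: bdd_scale (@bdd_id _ _).
  - by rewrite /= !scale0r linear0.
  - by rewrite /psum !big_ord0 /= !scale0r !linear0 !addr0.
have [h [h_bdd hT hE]] := sub_iter_factor r n T_bdd.
exists (g \+ (alpha n)%:C \*: h); split=> [|x|x].
- by apply: bdd_add => //; exact: bdd_scale.
- by rewrite /= gT hT (linearD T) (linearZZ T).
- rewrite psumSr big_ord_recr /= rmorphD scalerDl opprD addrACA gE.
  rewrite rmorphM -scalerA -scalerBr hE /= (linearD T) (linearZZ T) scalerDr opprD addrACA.
  by rewrite scalerN [in RHS]scalerDr !scalerA [r%:C * _]mulrC.
Qed.

(* [p(r) - p(T) = (r - T) g(T)] for a polynomial [g], so inverting the left-hand
   side inverts [r - T]. *)
Lemma resolvent_psum (T : {linear V -> V}) (r : R) alpha n : bdd T ->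
  resolvent (psum alpha T n) (\sum_(j < n) alpha j * r ^+ j)%:C -> resolvent T r%:C.
Proof.
move=> T_bdd [S [S_bdd Sl Sr]].
have [g [g_bdd gT gE]] := sub_psum_factor r alpha n T_bdd.
have right_inv x : r%:C *: g (S x) - T (g (S x)) = x by rewrite -gE Sr.
have left_inv x : S (g (r%:C *: x - T x)) = x.
  by rewrite linearB linearZZ gT -gE Sl.
(* A right inverse g S and a left inverse S g of r - T must agree. *)
have gS x : g (S x) = S (g x) by rewrite -{2}(right_inv x) left_inv.
exists (g \o S); split=> [|x|x] /=; [exact: bdd_comp | | exact: right_inv].
by rewrite gS left_inv.
Qed.

(** Divide k by m with remainder p < m. The factor T^p costs at most (c / s)^p <= (c / s)^m, where c
    >= s is a bound for [T]. *)
Lemma growth_iter (T : V -> V) s m : (0 < m)%N -> 0 < s -> bdd T ->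
  growth (iter m T) (s ^+ m) -> growth T s.
Proof.
move=> m0 s0 /(bdd_ge s)[c cs Tc] /(growth_gt0 (exprn_ge0 _ (ltW s0)))[d d0 Td].
have c0 : 0 <= c by apply: le_trans cs; exact: ltW.
have c1 : 1 <= c / s by rewrite ler_pdivlMr // mul1r.
exists ((c / s) ^+ m * d) => k x.
have iterM j y : iter (j * m) T y = iter j (iter m T) y.
  by elim: j => //= j IHj; rewrite mulSn iterD IHj.
rewrite {1}(divn_eq k m) addnC iterD iterM.
apply: le_trans (bdd_iter c0 Tc _ _) _.
apply: le_trans (ler_wpM2l (exprn_ge0 _ c0) (Td _ _)) _.
have -> : c ^+ (k %% m) * (d * (s ^+ m) ^+ (k %/ m) * nrm x) =
    (c / s) ^+ (k %% m) * (d * s ^+ k * nrm x).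
  rewrite [in s ^+ k](divn_eq k m) exprD expr_div_n mulnC exprM; field.
  by rewrite expf_neq0 // gt_eqF.
rewrite -!mulrA ler_wpM2r ?mulr_ge0 ?exprn_ge0 ?nrm_ge0 ?(ltW d0) ?(ltW s0) //.
by rewrite ler_weXn2l // ltnW // ltn_pmod.
Qed.

End PolynomialSpectrum.

(** * Radius of convergence, and convexity of powers *)

Section Radius.
Variable R : realType.
Implicit Types (alpha : nat -> R).

(** Take r < s < t with t below the radius: alpha_j t^j is bounded by some M, so the series at s is
    dominated by a geometric one of ratio s / t. *)
Lemma lt_convergence_radius alpha r : (forall j, 0 <= alpha j) -> 0 <= r ->
  (r%:E < convergence_radius alpha)%E ->
  exists2 s, r < s & exists B, forall n, \sum_(j < n) alpha j * s ^+ j <= B.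
Proof.
move=> alpha0 r0 r_lt.
have [t [rt t_lt]] : exists t, r < t /\
    (limn_esup (fun j : nat => (alpha j `^ (j%:R^-1))%:E) < t^-1%:E)%E.
  (* If the limit superior is 0, any t > r would do; the values +oo and -oo contradict [r_lt]; for a
     nonzero real l, t is the midpoint of r and 1 / l. *)
  move: r_lt; rewrite /convergence_radius; case: inveP => [_|||l l0].
  - by exists (r + 1); rewrite ltrDl lte_fin invr_gt0 ltr_wpDl.
  - by rewrite lte_fin ltNge r0.
  - by [].
  - rewrite lte_fin => rl; exists ((r + l^-1) / 2); split; first lra.
    have l1 : 0 < l^-1 by exact: le_lt_trans rl.
    by rewrite lte_fin -[ltLHS]invrK ltf_pV2 ?posrE //; lra.
have t0 : 0 < t by exact: le_lt_trans rt.
(* The limit superior is an infimum of suprema over the sets of the filter; on one of them, [U], the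
   roots of the coefficients stay below 1 / t. Indices from [N.+1] on are also nonzero, so the j-th
   power undoes the j-th root. *)
have [_ [U [N _ NU] <-] U_lt] := ereal_inf_lt t_lt.
have alphaN j : (N.+1 <= j)%N -> alpha j * t ^+ j <= 1.
  move=> Nj; have j0 : j%:R != 0 :> R by rewrite pnatr_eq0 -lt0n (leq_trans _ Nj).
  have : ((alpha j `^ j%:R^-1)%:E <= ereal_sup ((fun j => (alpha j `^ j%:R^-1)%:E) @` U))%E.
    by apply: ereal_sup_ubound; exists j => //; apply: NU; exact: ltnW.
  move=> /le_lt_trans /(_ U_lt); rewrite lte_fin => /ltW alpha_le.
  have -> : alpha j = (alpha j `^ j%:R^-1) ^+ j.
    by rewrite -powR_mulrn ?powR_ge0 // -powRrM mulVf // powRr1.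
  by rewrite -exprMn exprn_ile1 ?mulr_ge0 ?powR_ge0 ?(ltW t0) // -ler_pdivlMr // mul1r.
pose s := (r + t) / 2; exists s; first by rewrite /s; lra.
pose M := 1 + \sum_(j < N.+1) alpha j * t ^+ j.
have a0 j : 0 <= alpha j * t ^+ j by rewrite mulr_ge0 ?exprn_ge0 // ltW.
have M1 : 1 <= M by rewrite lerDl sumr_ge0.
have alphaM j : alpha j * t ^+ j <= M.
  have [Nj|jN] := leqP N.+1 j; first exact: le_trans (alphaN j Nj) M1.
  rewrite /M (bigD1 (Ordinal jN)) //= addrCA lerDl addr_ge0 // sumr_ge0 //.
exists (M / (1 - s / t)) => n.
have M0 : 0 <= M by lra.
apply: le_trans (geometric_sum_le n M0 _); last first.
  rewrite divr_ge0 ?(ltW t0) /s //=; last lra.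
  by rewrite ltr_pdivrMr // mul1r; lra.
have s0 : 0 <= s by rewrite /s; lra.
apply: ler_sum => j _; have -> : M * (s / t) ^+ j = M * s ^+ j / t ^+ j.
  by rewrite expr_div_n mulrA.
rewrite ler_pdivlMr ?exprn_gt0 //.
rewrite mulrAC; apply: ler_wpM2r => //; exact: exprn_ge0.
Qed.


(** In the induction the defect is c (1 - c) (t - r) (t^j - r^j) >= 0. This serves to compare f
    slightly to the right of r with f(r). *)
Lemma expr_convex (r t c : R) j : 0 <= r -> r <= t -> 0 <= c <= 1 ->
  ((1 - c) * r + c * t) ^+ j <= (1 - c) * r ^+ j + c * t ^+ j.
Proof.
move=> r0 rt /andP[c0 c1]; elim: j => [|j IHj]; first by rewrite !expr0; lra.
have x0 : 0 <= (1 - c) * r + c * t by apply: addr_ge0; apply: mulr_ge0; lra.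
rewrite !exprS; apply: le_trans (ler_wpM2l x0 IHj) _.
have : 0 <= c * (1 - c) * ((t - r) * (t ^+ j - r ^+ j)).
  apply: mulr_ge0; first by apply: mulr_ge0; lra.
  apply: mulr_ge0; first lra.
  by rewrite subr_ge0 lerXn2r // nnegrE //; lra.
by nra.
Qed.

End Radius.

(** * Positive operators on a sequence space *)

Section Lattice.
Variables (R : realType) (J : index_set) (L : banach_seq_space R J).
Hypothesis L_normalized : normalized_bss L.
Implicit Types (x y : L) (i : J) (T S : L -> L).

Lemma coordsD x y i : coords (x + y) i = coords x i + coords y i.
Proof. by have := coords_linear 1 x y i; rewrite scale1r mul1r. Qed.

Lemma coords0 i : coords (0 : L) i = 0.
Proof. by apply: (@addrI _ (coords (0 : L) i)); rewrite -coordsD !addr0. Qed.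

Lemma coordsZ a x i : coords (a *: x) i = a * coords x i.
Proof. by have := coords_linear a x 0 i; rewrite coords0 !addr0. Qed.

Lemma coordsB x y i : coords (x - y) i = coords x i - coords y i.
Proof. by rewrite coordsD -scaleN1r coordsZ mulN1r. Qed.

Lemma coords_sum (I : Type) (r : seq I) (F : I -> L) i :
  coords (\sum_(k <- r) F k) i = \sum_(k <- r) coords (F k) i.
Proof.
by elim: r => [|k r IHr]; rewrite ?big_nil ?coords0 // !big_cons coordsD IHr.
Qed.

Lemma coords_ext x y : (forall i, coords x i = coords y i) -> x = y.
Proof. by move=> xy; apply: coords_inj; apply/funext. Qed.

Lemma solid (u : J -> R[i]) y : (forall i, nrm (u i) <= nrm (coords y i)) ->
  exists x, [/\ forall i, coords x i = u i & nrm x <= nrm y].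
Proof.
move=> uy; have [i|x xu] := @coords_solid _ _ L u y; first by rewrite nrm_le.
by rewrite nrm_le => xy; exists x; split=> // i; rewrite xu.
Qed.

Lemma nrm_mono x y : (forall i, nrm (coords x i) <= nrm (coords y i)) -> nrm x <= nrm y.
Proof. by move=> /solid[z [/coords_ext ->]]. Qed.

Definition unitv i : L := xget 0 [set e : L | coords e = fun k => (k == i)%:R].

Lemma coords_unitv i k : coords (unitv i) k = (k == i)%:R.
Proof.
by rewrite /unitv; case: xgetP => [e _ ->|E] //; have [e /E] := L_normalized i.
Qed.

Lemma nrm_unitv i : nrm (unitv i) = 1.
Proof.
have [e eE e1] := L_normalized i.
have -> : unitv i = e by apply: coords_ext => k; rewrite coords_unitv eE.
by rewrite /nrm e1.
Qed.

(** The vector x_i e_i is dominated by x and has norm |x_i|. Hence limits in [L] are also limits of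
    coordinates. *)
Lemma nrm_coords x i : nrm (coords x i) <= nrm x.
Proof.
rewrite -[leLHS]mulr1 -(nrm_unitv i) -nrmZ; apply: nrm_mono => k.
rewrite coordsZ coords_unitv; case: eqP => [->|_]; first by rewrite mulr1.
by rewrite mulr0 nrm0 nrm_ge0.
Qed.

Lemma coords_lim (u : nat -> L) x i : lim_to u x -> lim_to (fun n => coords (u n) i) (coords x i).
Proof. by apply: null_le => n; rewrite -coordsB nrm_coords. Qed.

(** In the order of [R[i]] this makes [y] real and non-negative, so [dle y y] expresses membership
    in the positive cone. *)
Definition dle x y := forall i, `|coords x i| <= coords y i.

Lemma dle_nrm_coords x y i : dle x y -> nrm (coords x i) <= nrm (coords y i).
Proof.
move=> xy; rewrite -nrm_le; apply: le_trans (xy i) _.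
by rewrite ger0_norm // (le_trans _ (xy i)).
Qed.

Lemma dle_nrm x y : dle x y -> nrm x <= nrm y.
Proof. by move=> xy; apply: nrm_mono => i; exact: dle_nrm_coords. Qed.

Lemma dle_refl x y : dle x y -> dle y y.
Proof. by move=> xy i; rewrite ger0_norm // (le_trans _ (xy i)). Qed.

Lemma abs_exists x : exists y,
  (forall i, coords y i = (nrm (coords x i))%:C) /\ nrm y = nrm x.
Proof.
have nrmC i : nrm (nrm (coords x i))%:C = nrm (coords x i).
  by rewrite nrm_real ger0_norm ?nrm_ge0.
have [i|y [yE yx]] := @solid (fun i => (nrm (coords x i))%:C) x; first by rewrite nrmC.
exists y; split=> //.
by apply/le_anti; rewrite yx nrm_mono // => i; rewrite yE nrmC.
Qed.

Lemma dle_abs x : exists2 y, dle x y & nrm y = nrm x.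
Proof. by have [y [yE yx]] := abs_exists x; exists y => // i; rewrite yE normE. Qed.

Lemma dle_add x y x' y' : dle x y -> dle x' y' -> dle (x + x') (y + y').
Proof.
by move=> xy xy' i; rewrite !coordsD (le_trans (ler_normD _ _)) // lerD.
Qed.

Lemma dle_scale a b x y : `|a| <= b -> dle x y -> dle (a *: x) (b *: y).
Proof. by move=> ab xy i; rewrite !coordsZ normrM ler_pM. Qed.

Lemma dle_zero y : dle y y -> dle 0 y.
Proof. by move=> yy i; rewrite coords0 normr0 (le_trans _ (yy i)). Qed.

Lemma dle_lim (u v : nat -> L) x y :
  (forall n, dle (u n) (v n)) -> lim_to u x -> lim_to v y -> dle x y.
Proof.
move=> uv ux vy i.
exact: lim_norm_le (fun n => uv n i) (coords_lim i ux) (coords_lim i vy).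
Qed.

(** Entrywise domination |T x| <= S |x| in a form closed under composition, sums and limits. For
    linear [T], [dom T T] is positivity. *)
Definition dom T S := forall x y, dle x y -> dle (T x) (S y).

Lemma dom_iter T S k : dom T S -> dom (iter k T) (iter k S).
Proof. by move=> TS; elim: k => // k IHk x y /IHk; exact: TS. Qed.

Lemma dom_scale a T S : 0 <= a -> dom T S -> dom (fun x => a *: T x) (fun x => a *: S x).
Proof. by move=> a0 TS x y /TS; apply: dle_scale; rewrite ger0_norm. Qed.

Lemma dom_psum (alpha : nat -> R) T S n : (forall j, 0 <= alpha j) -> dom T S ->
  dom (psum alpha T n) (psum alpha S n).
Proof.
move=> alpha0 TS x y xy; rewrite /psum; elim: n => [|n IHn].
  by rewrite !big_ord0 => i; rewrite coords0 normr0.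
rewrite !big_ord_recr; apply: dle_add => //.
by apply: dom_scale xy; rewrite ?ler0c //; exact: dom_iter.
Qed.

Lemma dom_psum_le (alpha : nat -> R) T m n : (forall j, 0 <= alpha j) -> dom T T ->
  (m <= n)%N -> dom (psum alpha T m) (psum alpha T n).
Proof.
move=> alpha0 TT /subnKC <-; elim: (n - m)%N => [|k IHk].
  by rewrite addn0; exact: dom_psum.
move=> x y xy; rewrite addnS [psum _ _ _.+1 _]psumSr -[psum _ _ _ x]addr0.
apply: dle_add; first exact: IHk.
by apply: dle_zero; apply: dom_scale (dle_refl xy); rewrite ?ler0c //; exact: dom_iter.
Qed.

Lemma growth_dom T S s : dom T S -> growth S s -> growth T s.
Proof.
move=> TS [c Sc]; exists c => k x; have [y xy <-] := dle_abs x.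
by apply: le_trans (Sc k y); apply: dle_nrm; exact: dom_iter.
Qed.

End Lattice.

(** * The spectrum of a positive operator *)

Section PositiveOperator.
Variables (R : realType) (J : index_set) (L : banach_seq_space R J).
Hypothesis L_normalized : normalized_bss L.
Implicit Types (x y : L).

Lemma dom_lim (F G : L -> L) (u v : nat -> L -> L) :
  (forall n, dom (u n) (v n)) -> (forall x, lim_to (u ^~ x) (F x)) ->
  (forall x, lim_to (v ^~ x) (G x)) -> dom F G.
Proof.
move=> uv uF vG x y xy; apply: (dle_lim L_normalized _ (uF x) (vG y)) => n.
exact: uv.
Qed.

(** If the inverse is bounded by c, then |x| <= c^k |T^k x|; at the rate 1 / (2 c) the right side
    tends to 0, absurd for a unit vector. This settles the case r = 0 of the next lemma. *)
Lemma quasinilpotent_not_resolvent (T : {linear L -> L}) (i0 : J) :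
  (forall s, 0 < s -> growth T s) -> ~ resolvent T 0.
Proof.
move=> Tg [S [/(bdd_ge 1)[c c1 Sc] S1 _]]; have c0 : 0 < c by lra.
have [|d Td] := Tg (2 * c)^-1; first by rewrite invr_gt0; lra.
pose e := unitv L i0; have e1 : nrm e = 1 by exact: nrm_unitv.
have Siter k x : nrm x <= c ^+ k * nrm (iter k T x).
  elim: k x => [|k IHk] x; first by rewrite expr0 mul1r.
  apply: le_trans (IHk x) _; rewrite exprSr -mulrA ler_wpM2l ?exprn_ge0 //; first lra.
  by rewrite -{1}(S1 (iter k T x)) scale0r sub0r (le_trans (Sc _)) // nrmN.
suff : 1 <= 0 :> R by rewrite ler10.
apply: (@null_const_le0 _ _ (fun n => d * (2^-1) ^+ n)); last first.
  by apply: null_geometric; lra.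
move=> n; have := Siter n e; rewrite e1 => /le_trans; apply.
apply: le_trans (ler_wpM2l _ (Td n e)) _; first by rewrite exprn_ge0 // ltW.
rewrite e1 mulr1 invfM exprMn [(c^-1) ^+ n]exprVn.
have cn0 : c ^+ n != 0 by rewrite expf_neq0 // gt_eqF.
by rewrite le_eqVlt; apply/orP; left; apply/eqP; field.
Qed.

(* If [r] is in the resolvent set then, resolvents at points [t > r] being
   positive Neumann series, so is the right inverse of [l - T] at some [l < r];
   iterating [l R = 1 + T R] gives [T^k <= l^(k+1) R], whose growth rate [l]
   contradicts the minimality of [r]. *)
Lemma positive_growth_spectrum (T : {linear L -> L}) (i0 : J) : bdd T -> dom T T ->
  exists r : R, [/\ 0 <= r, ~ resolvent T r%:C & forall s, r < s -> growth T s].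
Proof.
move=> T_bdd TT; pose G := [set s : R | 0 <= s /\ growth T s].
have G_inf : has_inf G.
  by split; [have [s] := bdd_growth T_bdd; exists s | exists 0 => s []].
pose r := inf G; have r0 : 0 <= r by apply: lb_le_inf G_inf.1 _ => s [].
have Tg s : r < s -> growth T s.
  rewrite -subr_gt0 => /inf_adherent/(_ G_inf)[t [t0 Tt] rt].
  by apply: growth_le Tt; rewrite // /r; lra.
exists r; split=> // Tr.
have [r_eq0|r_neq0] := eqVneq r 0.
  by move: Tr; rewrite r_eq0; apply: quasinilpotent_not_resolvent => // s; rewrite -r_eq0; exact: Tg.
have r_gt0 : 0 < r by rewrite lt_neqAle eq_sym r_neq0.
have [R0 [R0_bdd R0l _]] := Tr.
(* The bound K >= 1 / r is what makes the later point l = r - 1 / (4 K) non-negative. *)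
have [K rK R0K] := bdd_ge (1 / r) R0_bdd.
have K0 : 0 < K by apply: lt_le_trans rK; rewrite divr_gt0.
have rK1 : 1 <= K * r by move: rK; rewrite ler_pdivrMr.
pose t := r + 1 / (4 * K).
have rt : r < t by rewrite ltrDl divr_gt0 // mulr_gt0.
have t0 : 0 < t by exact: lt_trans rt.
have [|||F [_ F_lim Fl Fr]] := @resolvent_series _ _ T ((r + t) / 2) t%:C; first lra.
- by apply: Tg; lra.
- by rewrite nrm_real ger0_norm; lra.
have tV0 : 0 <= t^-1 by rewrite invr_ge0 ltW.
have FF : dom F F.
  apply: (dom_lim _ F_lim F_lim) => n; rewrite -fmorphV; apply: dom_scale; first by rewrite ler0c.
  by apply: dom_psum => //; apply: dom_scale; rewrite ?ler0c.
(* The resolvent identity F = R0 (1 - (t - r) F) and K (t - r) = 1/4 give |F x| <= K |x| + |F x| /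
   4. *)
have Fb x : nrm (F x) <= 4 / 3 * K * nrm x.
  have : F x = R0 (x - (t - r)%:C *: F x).
    by rewrite -{2}(Fr x) rmorphB scalerBl opprB addrC addrA subrK R0l.
  move=> /(congr1 (@nrm R L)) E.
  have := le_trans (R0K (x - (t - r)%:C *: F x)) (ler_wpM2l (ltW K0) (nrmB _ _)).
  have tr : 0 <= t - r by rewrite subr_ge0 ltW.
  rewrite -E nrm_realZ // mulrDr mulrA.
  have -> : K * (t - r) = 1 / 4 by rewrite /t; field; rewrite gt_eqF.
  lra.
(* The step [d] is twice t - r, so t - d lies to the left of r, and yet |d F| <= 2/3: the Neumann
   series for (1 - d F)^-1 converges and is positive. *)
pose d := 1 / (2 * K).
have d0 : 0 < d by rewrite divr_gt0 // mulr_gt0.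
have dF x : nrm (d%:C *: F x) <= 2 / 3 * nrm x.
  rewrite nrm_realZ ?(ltW d0) //; apply: le_trans (ler_wpM2l (ltW d0) (Fb x)) _.
  by rewrite le_eqVlt; apply/orP; left; apply/eqP; rewrite /d; field; rewrite gt_eqF.
have [||F' [F'_lim F'_bdd F'E _]] := @neumann_series _ _ (d%:C \*: F) (2 / 3); first lra.
- by exists 1 => k x; rewrite mul1r; apply: (bdd_iter _ dF); lra.
have F'F' : dom F' F'.
  apply: (dom_lim _ F'_lim F'_lim) => n.
  by apply: dom_psum => //; apply: dom_scale FF; rewrite ler0c ltW.
pose l := t - d; pose Q x := F (F' x).
have lr : l < r.
  have v0 : 0 < 1 / (4 * K) by rewrite divr_gt0 // mulr_gt0.
  have : d = 2 * (1 / (4 * K)) by rewrite /d; field; rewrite gt_eqF.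
  rewrite /l /t; lra.
have l0 : 0 <= l.
  have -> : l = r - 1 / (4 * K) by rewrite /l /t /d; field; rewrite gt_eqF.
  rewrite subr_ge0 ler_pdivrMr ?mulr_gt0 //; lra.
have QE x : l%:C *: Q x = x + T (Q x).
  have tQ : t%:C *: Q x = F' x + T (Q x) by rewrite -[F' x]Fr subrK.
  by rewrite /l rmorphB scalerBl tQ addrAC; congr (_ + _); exact: F'E.
have QQ : dom Q Q by move=> x y /F'F'/FF.
have iterQ k x y : dle x y -> dle (iter k T x) ((l ^+ k.+1)%:C *: Q y).
  move=> xy; elim: k => [|k IHk].
    rewrite expr1 QE -[x]addr0; apply: (dle_add xy); apply: dle_zero.
    exact: TT (QQ _ _ (dle_refl xy)).
  rewrite iterS exprSr rmorphM -scalerA QE scalerDr -[T _]add0r; apply: dle_add.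
    by apply/dle_zero/dle_scale/(dle_refl xy); rewrite ger0_norm // ler0c exprn_ge0.
  by rewrite -linearZZ; exact: TT.
have /(bdd_ge 0)[c c0 Qc] : bdd Q by apply: bdd_comp => //; exists (4 / 3 * K).
have : G l.
  split=> //; exists (c * l) => k x; have [y xy <-] := dle_abs x.
  apply: le_trans (dle_nrm (iterQ k x y xy)) _.
  rewrite nrm_realZ ?exprn_ge0 //; apply: le_trans (ler_wpM2l _ (Qc y)) _.
    exact: exprn_ge0.
  by rewrite exprS le_eqVlt; apply/orP; left; apply/eqP; ring.
by move=> /(inf_lbound G_inf.2); rewrite leNgt lr.
Qed.

End PositiveOperator.

(** * Matrices as operators *)

Section InfiniteSums.

(** Finite lists exhausting [J]; for finite [J] the list is all of [J] whatever [n] is. Both cases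
    of [has_isum] thereby become limits of sums over [fseq J n]. *)
Definition fseq (J : index_set) (n : nat) : seq J :=
  match J with Initial k => enum 'I_k.+1 | Naturals => iota 0 n end.

Lemma fseq_cat (J : index_set) m n : (m <= n)%N -> exists l, fseq J n = fseq J m ++ l.
Proof.
case: J => [k|] mn; first by exists [::]; rewrite cats0.
by exists (iota m (n - m)); rewrite -iotaD subnKC.
Qed.

Lemma fseq_uniq (J : index_set) n : uniq (fseq J n).
Proof. by case: J => [k|]; [exact: enum_uniq | exact: iota_uniq]. Qed.

Lemma fseq_mem (J : index_set) (i : J) : exists N, forall n, (N <= n)%N -> i \in fseq J n.
Proof.
case: J i => [k|] i; first by exists 0%N => n _; exact: mem_enum.
by exists i.+1 => n; rewrite mem_iota.
Qed.

Lemma has_isumP (K : numFieldType) (J : index_set) (u : J -> K) s :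
  has_isum u s <-> forall e, 0 < e -> exists N, forall n, (N <= n)%N ->
    `|\sum_(j <- fseq J n) u j - s| <= e.
Proof.
case: J u => [k|] u /=.
  rewrite -[\sum_(j < k.+1) u j]big_enum /=.
  split=> [-> e e0|us]; first by exists 0%N => n _; rewrite subrr normr0 ltW.
  apply/eqP; rewrite -subr_eq0 -normr_le0; apply/ler_addgt0Pl => e e0.
  by have [N HN] := us e e0; rewrite addr0; exact: HN (leqnn N).
have -> : series u = fun n => \sum_(j <- iota 0 n) u j.
  by apply/funext => n; rewrite /series /= /index_iota subn0.
split=> [/cvgrPdist_le us e /us[N _ HN]|us].
  by exists N => n /HN; rewrite distrC.
apply/cvgrPdist_le => e /us[N HN].
by exists N => // n /HN; rewrite /= distrC.
Qed.

Variable R : realType.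

Lemma has_isum_complexP (J : index_set) (u : J -> R[i]) s :
  has_isum u s <-> lim_to (fun n => \sum_(j <- fseq J n) u j) s.
Proof.
split=> [/has_isumP us e e0|us].
  have [|N HN] := us e%:C; first by rewrite ltcR.
  by exists N => n /HN; rewrite normE lecR.
by apply/has_isumP => ce /complex_gt0[]; set e := complex.Re ce => /us[N HN] ->;
  exists N => n /HN; rewrite normE lecR.
Qed.

Lemma has_isum_realP (J : index_set) (u : J -> R) s :
  has_isum u s <-> has_isum (fun j => (u j)%:C) s%:C.
Proof.
have E n : nrm (\sum_(j <- fseq J n) (u j)%:C - s%:C) = `|\sum_(j <- fseq J n) u j - s|.
  by rewrite -rmorph_sum -rmorphB nrm_real.
split=> [/has_isumP us|/has_isum_complexP us].
  by apply/has_isum_complexP => e /us[N HN]; exists N => n; rewrite E; exact: HN.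
by apply/has_isumP => e /us[N HN]; exists N => n; rewrite -E; exact: HN.
Qed.

Lemma isumE (J : index_set) (u : J -> R) s : has_isum u s -> isum u = s.
Proof.
move=> us; apply: xget_unique => // t ut; apply: complexI.
apply: lim_to_unique.
  by apply/has_isum_complexP/has_isum_realP; exact: ut.
by apply/has_isum_complexP/has_isum_realP.
Qed.

Lemma has_isum_le (J : index_set) (u : J -> R) s c : has_isum u s ->
  (forall n, \sum_(j <- fseq J n) u j <= c) -> s <= c.
Proof.
move=> /has_isumP us uc; apply/ler_addgt0Pr => e /us[N /(_ _ (leqnn N))].
by have := uc N; rewrite ler_norml; lra.
Qed.

Lemma has_isum_ge (J : index_set) (u : J -> R) s n : (forall j, 0 <= u j) ->
  has_isum u s -> \sum_(j <- fseq J n) u j <= s.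
Proof.
move=> u0 /has_isumP us; apply/ler_addgt0Pr => e /us[N /(_ _ (leq_maxl N n))].
have [l ->] := @fseq_cat J n (maxn N n) (leq_maxr _ _).
rewrite big_cat /= ler_norml.
have : 0 <= \sum_(j <- l) u j by exact: sumr_ge0.
by lra.
Qed.

(** Expanding a product of finite sums yields the sum of products plus non-negative mixed terms. At
    least one factor is required: empty products would sum to the number of indices. *)
Lemma has_isum_prod_le (J : index_set) m (u : 'I_m.+1 -> J -> R) (v : J -> R)
    (s : 'I_m.+1 -> R) t : (forall k j, 0 <= u k j) ->
  (forall k, has_isum (u k) (s k)) -> has_isum v t ->
  (forall j, v j <= \prod_k u k j) -> t <= \prod_k s k.
Proof.
move=> u0 us vt vu; apply: has_isum_le vt _ => n.
apply: (@le_trans _ _ (\prod_k \sum_(j <- fseq J n) u k j)); last first.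
  apply: ler_prod => k _; rewrite sumr_ge0 //=; exact: has_isum_ge (us k).
apply: le_trans (ler_sum _ (fun j _ => vu j)) _.
elim: m u {us vu s} u0 => [|m IHm] u u0.
  by rewrite big_ord1; under eq_bigr do rewrite big_ord1.
under [leLHS]eq_bigr do rewrite big_ord_recl.
rewrite big_ord_recl; apply: le_trans (ler_wpM2l _ (IHm _ _)); last 2 first.
- by rewrite sumr_ge0.
- by move=> k j; exact: u0.
rewrite mulr_suml big_seq [leRHS]big_seq; apply: ler_sum => j js.
rewrite ler_wpM2l // (big_rem _ js) /= lerDl sumr_ge0 // => i _.
by rewrite prodr_ge0.
Qed.

End InfiniteSums.

(** * Non-negative matrices on [L]: boundedness, products, domination *)

Section MatrixOperators.
Variables (R : realType) (J : index_set) (L : banach_seq_space R J).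
Hypothesis L_normalized : normalized_bss L.
Implicit Types (x y z : L) (i : J) (A B : imatrix R J) (T S : L -> L).

Definition represents A T := forall x : L, is_imx_image A x (T x).

Lemma representsP A T : represents A T <-> forall x i,
  lim_to (fun n => \sum_(j <- fseq J n) (A i j)%:C * coords x j) (coords (T x) i).
Proof. by split=> AT x i; apply/has_isum_complexP; exact: AT. Qed.

Lemma represents_linear A T : represents A T -> exists S : {linear L -> L}, T = S.
Proof.
move=> /representsP AT; apply: linear_bundle => a x y; apply: coords_ext => i.
apply: lim_to_unique (AT _ i) _; rewrite coordsD coordsZ.
apply: (@null_le _ (fun n => nrm (a *: \sum_(j <- fseq J n) (A i j)%:C * coords x j +
    \sum_(j <- fseq J n) (A i j)%:C * coords y j -
    (a *: coords (T x) i + coords (T y) i)))); last first.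
  exact: lim_to_add (@lim_to_scale _ R[i]^o _ _ _ (AT x i)) (AT y i).
move=> n; rewrite /GRing.scale /= mulr_sumr -big_split /=.
by under eq_bigr do rewrite coordsD coordsZ mulrDr mulrCA.
Qed.

Lemma imx_opE A T : represents A T -> imx_op L A = T.
Proof.
move=> AT; apply/funext => x; apply: xget_unique; first exact: AT.
move=> y Ay; apply: coords_ext => i.
by apply: lim_to_unique; apply/has_isum_complexP; [exact: Ay | exact: AT].
Qed.

Lemma defines_operator_represents A :
  defines_operator L A -> represents A (imx_op L A).
Proof. by move=> A_op x; rewrite /imx_op; case: xgetP => // /(_ _)E; have [y /E] := A_op x. Qed.

Lemma represents_dom A B T S c : (forall i j, 0 <= A i j <= c * B i j) ->
  represents A T -> represents B S -> dom T (fun y => c%:C *: S y).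
Proof.
move=> AB /representsP AT /representsP BS x y xy i.
rewrite coordsZ.
apply: (lim_norm_le _ (AT x i) (@lim_to_scale _ R[i]^o c%:C _ _ (BS y i))) => n.
apply: le_trans (ler_norm_sum _ _ _) _; rewrite /GRing.scale /= mulr_sumr.
apply: ler_sum => j _; have /andP[A0 AcB] := AB i j.
rewrite normrM mulrA ler_pM // ger0_norm ?ler0c //.
by rewrite -(rmorphM (real_complex R)) lecR.
Qed.

Lemma represents_positive A T : nonneg_imx A -> represents A T -> dom T T.
Proof.
move=> A0 AT x y xy; rewrite -[T y]scale1r -(rmorph1 (real_complex R)).
by apply: (represents_dom _ AT AT) xy => i j; rewrite A0 mul1r lexx.
Qed.

Lemma represents_unitv A T i j : represents A T ->
  coords (T (unitv L j)) i = (A i j)%:C.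
Proof.
move=> /representsP AT; apply: lim_to_unique (AT _ i) _ => e e0.
have [N HN] := fseq_mem j; exists N => n /HN jn.
rewrite (bigD1_seq j) ?fseq_uniq //= coords_unitv // eqxx mulr1 big1 ?addr0 ?subrr ?nrm0 ?ltW //.
by move=> k kj; rewrite coords_unitv // (negPf kj) mulr0.
Qed.

(** The entry is a coordinate of T e_j; |e_j| = 1 and coordinates do not exceed the norm. *)
Lemma represents_bound A T c i j : nonneg_imx A -> represents A T ->
  (forall x, nrm (T x) <= c * nrm x) -> A i j <= c.
Proof.
move=> A0 AT Tc; have := Tc (unitv L j); rewrite nrm_unitv // mulr1; apply: le_trans.
have := nrm_coords L_normalized (T (unitv L j)) i.
by rewrite (represents_unitv _ _ AT) nrm_real ger0_norm.
Qed.

(* Otherwise there are [y_n >= 0] with [|y_n| <= 2^-n] and [|T y_n| > n], and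
   [T] takes no value of finite norm at [\sum_n y_n]. *)
Lemma represents_bdd A T : nonneg_imx A -> represents A T -> bdd T.
Proof.
move=> A0 AT; have TT := represents_positive A0 AT.
have [S TS] := represents_linear AT; rewrite {}TS in AT TT *.
apply: contrapT => S_unbdd.
have /choice[y yE] : forall n : nat, exists y,
    [/\ dle y y, nrm y <= 1 * 2^-1 ^+ n & n%:R < nrm (S y)].
  move=> n; apply: contrapT => no_y; apply: S_unbdd.
  exists (n%:R * 2 ^+ n) => x; rewrite leNgt; apply/negP => Sx.
  have x0 : 0 < nrm x.
    rewrite lt_neqAle nrm_ge0 andbT; apply/negP => /eqP x0; move: Sx.
    by rewrite (@nrm_le0 _ _ x) -?x0 // linear0 nrm0 mulr0 ltxx.
  have [y xy yx] := dle_abs x; apply: no_y.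
  have a0 : 0 < (nrm x * 2 ^+ n)^-1 by rewrite invr_gt0 mulr_gt0 // exprn_gt0.
  exists (((nrm x * 2 ^+ n)^-1)%:C *: y); split.
  - by apply: dle_scale (dle_refl xy); rewrite ger0_norm // ler0c ltW.
  - by rewrite nrm_realZ ?(ltW a0) // yx mul1r invfM mulrC mulrA mulfV ?gt_eqF // mul1r exprVn.
  - rewrite linearZ /= nrm_realZ ?(ltW a0) // mulrC ltr_pdivlMr ?mulr_gt0 ?exprn_gt0 //.
    by rewrite [nrm x * _]mulrC mulrA (lt_le_trans Sx) // dle_nrm //; exact: TT.
have y_small n : nrm (y n) <= 1 * 2^-1 ^+ n by have [] := yE n.
have [|z z_lim] := @series_lim _ _ y _ (1 / (1 - 2^-1)) y_small.
  by move=> n; apply: geometric_sum_le; lra.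
have yz n : dle (y n) z.
  (* From index [n.+1] on, the partial sums contain [y n], and their other terms are
     non-negative. *)
  apply: (dle_lim L_normalized _ (lim_to_const (y n)) (lim_to_shift n.+1 z_lim)).
  elim=> [|m IHm].
    rewrite add0n big_ord_recr /= -[X in dle X _]add0r; apply: dle_add; last by have [] := yE n.
    apply: dle_zero => //; elim: n => [|n IHn].
      by rewrite big_ord0 => i; rewrite coords0 normr0.
    by rewrite big_ord_recr; apply: dle_add => //; have [] := yE n.
  rewrite addSn big_ord_recr /= -[X in dle X _]addr0; apply: (dle_add IHm).
  by apply: dle_zero => //; have [] := yE (m + n.+1)%N.
have [_ _] := yE (Num.truncn (nrm (S z))).+1; apply/negP; rewrite -leNgt.
apply: le_trans (dle_nrm (TT _ _ (yz _))) _.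
by rewrite ltW // truncnS_gt.
Qed.

Definition trunc n x : L := \sum_(j <- fseq J n) coords x j *: unitv L j.

Lemma coords_trunc n x i : coords (trunc n x) i = if i \in fseq J n then coords x i else 0.
Proof.
rewrite coords_sum.
have Ej j : coords (coords x j *: unitv L j) i = if i == j then coords x i else 0.
  by rewrite coordsZ coords_unitv //; case: eqP => [->|]; rewrite ?mulr1 ?mulr0.
under eq_bigr do rewrite Ej.
case: ifPn => [im|inm]; last first.
  by rewrite big_seq big1 // => j js; case: eqP => // ij; rewrite ij js in inm.
rewrite (bigD1_seq i) ?fseq_uniq //= eqxx big1 ?addr0 // => j ji.
by rewrite eq_sym (negPf ji).
Qed.

Lemma dle_trunc n x y : dle x y -> dle (x - trunc n x) (y - trunc n y).
Proof.
by move=> xy i; rewrite !coordsB !coords_trunc; case: ifP; rewrite ?subrr ?normr0 ?subr0.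
Qed.

Lemma represents_trunc A (T : {linear L -> L}) n x i : represents A T ->
  coords (T (trunc n x)) i = \sum_(j <- fseq J n) (A i j)%:C * coords x j.
Proof.
move=> AT; rewrite linear_sum coords_sum; apply: eq_bigr => j _.
by rewrite linearZ coordsZ (represents_unitv _ _ AT) mulrC.
Qed.

(** Dominated convergence: outside finitely many indices the contribution is at most a tail of (A
    z)_i, and on these indices each term tends to 0. It replaces norm continuity, as truncations
    need not converge in the norm of [L]. *)
Lemma represents_order_continuous A T (w : nat -> L) z i : nonneg_imx A ->
  represents A T -> (forall n, dle (w n) z) ->
  (forall k, lim_to (fun n => coords (w n) k) 0) -> lim_to (fun n => coords (T (w n)) i) 0.
Proof.
move=> A0 AT wz w0; have TT := represents_positive A0 AT.
have [S TS] := represents_linear AT; rewrite {}TS in AT TT *.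
move=> e e0; have e20 : 0 < e / 2 by rewrite divr_gt0.
have [M HM] := (representsP _ _).1 AT z i _ e20; have {HM} := HM M (leqnn M).
rewrite -(represents_trunc _ _ _ AT) nrm_distC -coordsB -linearB => zM.
have : lim_to (fun n => coords (S (trunc M (w n))) i) 0.
  under eq_fun do rewrite (represents_trunc _ _ _ AT).
  have : lim_to (fun n => \sum_(j <- fseq J M) (A i j)%:C * coords (w n) j)
      (\sum_(j <- fseq J M) (A i j)%:C * 0).
    apply: lim_to_sum => j.
    exact: (@lim_to_scale _ R[i]^o (A i j)%:C _ _ (w0 j)).
  by rewrite big1 // => j _; rewrite mulr0.
move=> /(_ _ e20)[N HN]; exists N => n /HN; rewrite !subr0 => wM.
rewrite -[w n](subrK (trunc M (w n))) linearD coordsD.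
apply: le_trans (nrmD _ _) _.
have := dle_nrm_coords i (TT _ _ (dle_trunc M (wz n))); lra.
Qed.

(** The sum is the i-th coordinate of T (S e_j), so it converges and [isum] does not take its
    default value. *)
Lemma imulmx_isum A B T S : nonneg_imx A -> represents A T -> represents B S ->
  forall i j, has_isum (fun k => A i k * B k j) (imulmx A B i j).
Proof.
move=> A0 AT BS i j.
pose c := coords (T (S (unitv L j))) i.
have ABc : has_isum (fun k => (A i k * B k j)%:C) c.
  rewrite (_ : (fun k => _) = fun k => (A i k)%:C * coords (S (unitv L j)) k); first exact: AT.
  by apply/funext => k; rewrite rmorphM (represents_unitv _ _ BS).
suff H : has_isum (fun k => A i k * B k j) (complex.Re c) by rewrite /imulmx (isumE H).
apply/has_isum_realP; rewrite -(@lim_to_real _ (fun n => \sum_(k <- fseq J n) A i k * B k j)) //.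
have /has_isum_complexP := ABc; apply: null_le => n.
by rewrite rmorph_sum.
Qed.

(** The formula holds on truncations of x. The images under S of the remainders tend to 0 entrywise
    and are dominated by S |x|, so order continuity of T gives the limit. *)
Lemma imulmx_represents A B T S : nonneg_imx A -> nonneg_imx B ->
  represents A T -> represents B S -> represents (imulmx A B) (T \o S).
Proof.
move=> A0 B0 AT BS; have [T' TT] := represents_linear AT.
have [S' SS] := represents_linear BS; rewrite {}TT {}SS in AT BS *.
have ABE i j : (imulmx A B i j)%:C = coords (T' (S' (unitv L j))) i.
  have /has_isum_realP/has_isum_complexP H := imulmx_isum A0 AT BS i j.
  apply: lim_to_unique H _; apply/has_isum_complexP.
  rewrite (_ : (fun k => _) = fun k => (A i k)%:C * coords (S' (unitv L j)) k); first exact: AT.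
  by apply/funext => k; rewrite rmorphM (represents_unitv _ _ BS).
apply/representsP => x i /=.
have ABtrunc n : \sum_(j <- fseq J n) (imulmx A B i j)%:C * coords x j =
    coords (T' (S' (trunc n x))) i.
  rewrite /trunc !linear_sum coords_sum; apply: eq_bigr => j _.
  by rewrite !linearZ coordsZ ABE mulrC.
have [y xy _] := dle_abs x.
have : lim_to (fun n => coords (T' (S' (x - trunc n x))) i) 0.
  apply: (represents_order_continuous i A0 AT (z := S' y)) => [n|k].
    apply: (represents_positive B0 BS) => k.
    rewrite coordsB coords_trunc; case: ifP => _; last by rewrite subr0; exact: xy.
    by rewrite subrr normr0 (le_trans _ (xy k)).
  apply: null_le ((representsP _ _).1 BS x k) => n.
  by rewrite subr0 -(represents_trunc _ _ _ BS) nrm_distC -coordsB -linearB.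
apply: null_le => n.
by rewrite subr0 ABtrunc nrm_distC -coordsB -!linearB.
Qed.

Lemma imulmx_nonneg A B T S : nonneg_imx A -> nonneg_imx B ->
  represents A T -> represents B S -> nonneg_imx (imulmx A B).
Proof.
move=> A0 B0 AT BS i j.
have /(has_isum_ge 0) : has_isum (fun k => A i k * B k j) (imulmx A B i j).
  exact: imulmx_isum AT BS i j.
by move=> H; apply: le_trans (H _); [rewrite sumr_ge0 // => k _|move=> k]; rewrite mulr_ge0.
Qed.

Lemma imx1_represents : represents (@imx1 R J) (idfun : L -> L).
Proof.
apply/representsP => x i e e0; have [N HN] := fseq_mem i; exists N => n /HN iN.
rewrite (bigD1_seq i) ?fseq_uniq //= /imx1 eqxx mul1r big1 ?addr0 ?subrr ?nrm0 ?ltW //.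
by move=> j ji; rewrite eq_sym (negPf ji) mul0r.
Qed.

(** The sums defining A x converge absolutely, being dominated by those of c B |x|; solidity then
    puts the result in [L]. *)
Lemma dominated_defines_operator A B S c : (forall i j, 0 <= A i j <= c * B i j) ->
  represents B S -> defines_operator L A.
Proof.
move=> AB /representsP BS x; have [y [yE _]] := abs_exists x.
pose b i j := c * B i j * nrm (coords x j).
have Ab i j : nrm ((A i j)%:C * coords x j) <= b i j.
  have /andP[A0 AcB] := AB i j.
  by rewrite nrmM nrm_real ger0_norm // ler_wpM2r ?nrm_ge0.
have b_lim i : lim_to (fun n => (\sum_(j <- fseq J n) b i j)%:C) (c%:C * coords (S y) i).
  apply: null_le (@lim_to_scale _ R[i]^o c%:C _ _ (BS y i)) => n.
  rewrite rmorph_sum /GRing.scale /= mulr_sumr.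
  rewrite le_eqVlt; apply/orP; left; apply/eqP; congr (nrm (_ - _)); apply: eq_bigr => j _.
  by rewrite /b yE -mulrA !rmorphM.
have /choice[z zE] : forall i, exists z : R[i],
    lim_to (fun n => \sum_(j <- fseq J n) (A i j)%:C * coords x j) z.
  move=> i; pose u n := \sum_(j <- fseq J n) (A i j)%:C * coords x j.
  (* Scalar completeness is taken from [L] itself, along the line spanned by the unit vector e_i. *)
  have [|w wE] := @complete_lim _ L (fun n => u n *: unitv L i).
    move=> e e0; have e20 : 0 < e / 2 by rewrite divr_gt0.
    have [N HN] := b_lim i _ e20; exists N => m n Nm mn.
    rewrite -scalerBl nrmZ nrm_unitv // mulr1 /u.
    have := nrm_dist_triangle (c%:C * coords (S y) i)
      (\sum_(j <- fseq J n) b i j)%:C (\sum_(j <- fseq J m) b i j)%:C.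
    rewrite [X in _ <= _ + X]nrm_distC; have := HN m Nm; have := HN n (leq_trans Nm mn).
    rewrite -rmorphB nrm_real; have [l ->] := fseq_cat J mn.
    have cat_sub (V : zmodType) (f : J -> V) :
        \sum_(j <- fseq J m ++ l) f j - \sum_(j <- fseq J m) f j = \sum_(j <- l) f j.
      by rewrite big_cat /= addrAC subrr add0r.
    rewrite !cat_sub.
    move=> Hn Hm H; apply: le_trans (nrm_sum _ _) _.
    apply: le_trans (ler_sum _ (fun j _ => Ab i j)) _.
    by have := ler_norm (\sum_(j <- l) b i j); lra.
  exists (coords w i); apply: null_le (coords_lim L_normalized i wE) => n.
  by rewrite coordsZ coords_unitv // eqxx mulr1.
have [i|w [wE _]] := @solid _ _ _ z (c%:C *: S y).
  have zS : `|z i| <= c%:C * coords (S y) i.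
    apply: (lim_norm_le _ (zE i) (b_lim i)) => n.
    rewrite rmorph_sum; apply: le_trans (ler_norm_sum _ _ _) _.
    by apply: ler_sum => j _; rewrite normE lecR.
  by rewrite coordsZ -nrm_le (ger0_norm (le_trans _ zS)).
exists w => i; apply/has_isum_complexP; rewrite wE; exact: zE.
Qed.

End MatrixOperators.

(** * Words in the matrices and powers of the Hadamard product *)

Section Words.
Variables (R : realType) (J : index_set) (L : banach_seq_space R J).
Hypothesis L_normalized : normalized_bss L.

(* [A_a A_(a+1) ... A_(a+n-1)] *)
Fixpoint word_mx (A : nat -> imatrix R J) a n : imatrix R J :=
  if n is k.+1 then imulmx (A a) (word_mx A a.+1 k) else @imx1 R J.

Fixpoint word_op (T : nat -> L -> L) a n : L -> L :=
  if n is k.+1 then T a \o word_op T a.+1 k else idfun.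

Lemma imx1_nonneg : nonneg_imx (@imx1 R J).
Proof. by move=> i j; rewrite /imx1 ler0n. Qed.

Lemma word_mx_represents A T : (forall t, nonneg_imx (A t)) ->
  (forall t, represents (A t) (T t)) -> forall a n,
  nonneg_imx (word_mx A a n) /\ represents (word_mx A a n) (word_op T a n).
Proof.
move=> A0 AT a n; elim: n a => [|n IHn] a.
  by split; [exact: imx1_nonneg | exact: imx1_represents].
have [W0 WT] := IHn a.+1; split; first exact: (imulmx_nonneg L_normalized _ _ (AT a) WT).
exact: imulmx_represents.
Qed.

Lemma word_op_add T a n p x : word_op T a (n + p) x = word_op T a n (word_op T (a + n) p x).
Proof.
by elim: n a => [|n IHn] a; rewrite ?addn0 // addSn /= IHn addSnnS.
Qed.

Lemma word_op_periodic T m : (forall t, T (t + m)%N = T t) ->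
  forall a n, word_op T (a + m) n = word_op T a n.
Proof. by move=> Tm a n; elim: n a => //= n IHn a; rewrite Tm -addSn IHn. Qed.

Lemma word_op_mul T m : (forall t, T (t + m)%N = T t) ->
  forall n x, word_op T 0 (n * m) x = iter n (word_op T 0 m) x.
Proof.
move=> Tm; elim=> // n IHn x.
by rewrite mulSn word_op_add word_op_periodic // IHn.
Qed.

Lemma word_op_bdd T : (forall t, bdd (T t)) -> forall a n, bdd (word_op T a n).
Proof.
move=> Tb a n; elim: n a => [|n IHn] a /=; first exact: bdd_id.
exact: bdd_comp.
Qed.

Lemma big_imulmx A a n : \big[@imulmx R J/@imx1 R J]_(a <= k < a + n) A k = word_mx A a n.
Proof.
elim: n a => [|n IHn] a; first by rewrite addn0 big_geq.
by rewrite big_ltn ?ltnS ?leq_addr ?addnS ?ltnS ?leq_addr // -addSn IHn.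
Qed.

End Words.

(** * Hadamard products of a periodic sequence of matrices, and their powers *)

Section HadamardPower.
Variables (R : realType) (J : index_set) (L : banach_seq_space R J).
Hypothesis L_normalized : normalized_bss L.
Variables (m : nat) (A : nat -> imatrix R J) (T : nat -> L -> L).
Hypothesis A_ge0 : forall t, nonneg_imx (A t).
Hypothesis A_periodic : forall t, A (t + m.+1)%N = A t.
Hypothesis T_periodic : forall t, T (t + m.+1)%N = T t.
Hypothesis AT : forall t, represents (A t) (T t).

Let W_ge0 a n : nonneg_imx (word_mx A a n) :=
  (word_mx_represents L_normalized A_ge0 AT a n).1.
Let WT a n : represents (word_mx A a n) (word_op T a n) :=
  (word_mx_represents L_normalized A_ge0 AT a n).2.
Let T_bdd t : bdd (T t) := represents_bdd L_normalized (A_ge0 t) (@AT t).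

Definition cyclic_hadamard : imatrix R J := imx_hadamard (fun k : 'I_m.+1 => A k).

Lemma cyclic_hadamard_nonneg : nonneg_imx cyclic_hadamard.
Proof. by move=> i j; apply: prodr_ge0 => k _; exact: A_ge0. Qed.

Lemma word_mx_periodic a n : word_mx A (a + m.+1) n = word_mx A a n.
Proof. by elim: n a => //= n IHn a; rewrite A_periodic -addSn IHn. Qed.

(** The factors other than [A 0] have bounded entries, so the Hadamard product is at most a constant
    times [A 0]. *)
Lemma hadamard_defines_operator : defines_operator L cyclic_hadamard.
Proof.
have /choice[c cE] : forall t, exists c, forall i j, A t i j <= c.
  move=> t; have [c Tc] := T_bdd t; exists c => i j.
  exact: (represents_bound L_normalized _ _ (A_ge0 t) (@AT t)).
apply: (dominated_defines_operator L_normalized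
  (c := \prod_(k < m) c (lift ord0 k)) _ (@AT 0%N)) => i j.
rewrite cyclic_hadamard_nonneg /= /cyclic_hadamard /imx_hadamard big_ord_recl mulrC.
by rewrite ler_wpM2r ?A_ge0 // ler_prod // => k _; rewrite A_ge0 cE.
Qed.

Variable H : {linear L -> L}.
Hypothesis HH : represents cyclic_hadamard H.

Definition hadamard_pow n : imatrix R J := iter n (imulmx cyclic_hadamard) (@imx1 R J).

Lemma hadamard_pow_represents n :
  nonneg_imx (hadamard_pow n) /\ represents (hadamard_pow n) (iter n H).
Proof.
elim: n => [|n [P0 PH]]; first by split; [exact: imx1_nonneg | exact: imx1_represents].
split; last exact: (imulmx_represents L_normalized cyclic_hadamard_nonneg P0 HH PH).
exact: (imulmx_nonneg L_normalized cyclic_hadamard_nonneg P0 HH PH).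
Qed.

(** Each factor A_k(i,l) must meet the word starting at k + 1, while the induction hypothesis offers
    the words starting at k; by periodicity the two products over k differ only by a rotation. *)
Lemma hadamard_pow_le n i j :
  hadamard_pow n i j <= \prod_(k < m.+1) word_mx A k n i j.
Proof.
elim: n i j => [|n IHn] i j.
  rewrite /= /imx1; case: eqP => _; first by rewrite prodr_const expr1n.
  by apply: prodr_ge0.
have [P0 PH] := hadamard_pow_represents n.
apply: (@has_isum_prod_le _ J m (fun (k : 'I_m.+1) l => A k i l * word_mx A k.+1 n l j)
  (fun l => cyclic_hadamard i l * hadamard_pow n l j) (fun k => word_mx A k n.+1 i j)).
- by move=> k l; rewrite mulr_ge0 ?A_ge0 ?W_ge0.
- by move=> k; exact: (imulmx_isum L_normalized (A_ge0 k) (@AT k) (@WT k.+1 n)).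
- exact: (imulmx_isum L_normalized cyclic_hadamard_nonneg HH PH).
move=> l; rewrite big_split /= ler_wpM2l ?cyclic_hadamard_nonneg //.
apply: le_trans (IHn l j) _.
have W0 : word_mx A m.+1 n = word_mx A 0 n by rewrite -[m.+1]add0n word_mx_periodic.
by rewrite [leRHS]big_ord_recr big_ord_recl /= mulrC W0.
Qed.

(** Here [s] is a rate for a whole period of m + 1 factors. Bounding m + 1 words of n periods each
    gives the rate s^(m+1) for H^(m+1), hence s for H. *)
Lemma hadamard_growth s : 0 < s -> growth (word_op T 0 m.+1) s -> growth H s.
Proof.
move=> s0 /(growth_gt0 (ltW s0))[c c0 Pc].
have /choice[D D0E] : forall k : 'I_m.+1, exists D, 0 <= D /\ forall n x,
    nrm (word_op T k (n * m.+1) x) <= D * s ^+ n * nrm x.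
  move=> k; have [c1 c10 c1E] := bdd_ge 0 (word_op_bdd T_bdd k (m.+1 - k)).
  have [c2 c20 c2E] := bdd_ge 0 (word_op_bdd T_bdd 0 k).
  have d0 : 0 <= c1 * c * c2 / s by rewrite divr_ge0 ?mulr_ge0 // ltW.
  (* A word of n + 1 periods starting at k is a prefix of length m + 1 - k, then n full periods from
     0, then a suffix of length k. The division by s turns s^n into s^(n+1); the summand 1 covers
     the empty word. *)
  exists (c1 * c * c2 / s + 1); split=> [|[|n] x]; first by rewrite addr_ge0.
    by rewrite mul0n expr0 mulr1 mulrDl mul1r lerDr mulr_ge0 ?nrm_ge0.
  have -> : (n.+1 * m.+1 = (m.+1 - k) + (n * m.+1 + k))%N.
    by rewrite mulSn [(n * _ + k)%N]addnC addnA subnK // ltnW.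
  rewrite !word_op_add subnKC ?[(k <= _)%N]ltnW //.
  have periodic_mul q t p : word_op T (t + q * m.+1) p = word_op T t p.
    by elim: q => [|q IHq]; rewrite ?addn0 // mulSnr addnA word_op_periodic.
  rewrite -mulSn -[(n.+1 * _)%N]add0n periodic_mul.
  have -> : word_op T m.+1 (n * m.+1) = word_op T 0 (n * m.+1).
    by rewrite -[RHS](word_op_periodic T_periodic).
  rewrite word_op_mul //.
  apply: le_trans (c1E _) _; apply: le_trans (ler_wpM2l c10 (Pc _ _)) _.
  apply: (@le_trans _ _ (c1 * (c * s ^+ n * (c2 * nrm x)))).
    by rewrite ler_wpM2l // ler_wpM2l ?c2E // mulr_ge0 ?exprn_ge0 ?ltW.
  have -> : c1 * (c * s ^+ n * (c2 * nrm x)) = c1 * c * c2 / s * s ^+ n.+1 * nrm x.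
    by rewrite exprS; field; rewrite gt_eqF.
  by rewrite ler_wpM2r ?nrm_ge0 // ler_wpM2r ?exprn_ge0 ?lerDl // ltW.
have D0 k := (D0E k).1; have DE k := (D0E k).2.
apply: (@growth_iter _ _ H s m.+1) => //.
  exact: (represents_bdd L_normalized cyclic_hadamard_nonneg HH).
exists (\prod_k D k) => n x.
have iterM q y : iter q (iter m.+1 H) y = iter (q * m.+1) H y.
  by elim: q => //= q ->; rewrite -iterD.
rewrite {}iterM; have [P0 PH] := hadamard_pow_represents (n * m.+1).
have WD k i j : word_mx A (k : 'I_m.+1) (n * m.+1) i j <= D k * s ^+ n.
  exact: (represents_bound L_normalized _ _ (@W_ge0 _ _) (@WT _ _)).
(* All words but the one starting at 0 are bounded entrywise; that one is kept as an operator and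
   bounded in norm. *)
pose d := \prod_(k < m) (D (lift ord0 k) * s ^+ n).
have PW i j : 0 <= hadamard_pow (n * m.+1) i j <= d * word_mx A 0 (n * m.+1) i j.
  rewrite P0 /=; apply: le_trans (hadamard_pow_le _ _ _) _.
  rewrite big_ord_recl mulrC ler_wpM2r ?W_ge0 //.
  by apply: ler_prod => k _; rewrite W_ge0 WD.
have d0 : 0 <= d.
  by apply: prodr_ge0 => k _; rewrite mulr_ge0 ?exprn_ge0 // ltW.
have [y xy <-] := dle_abs x.
apply: le_trans (dle_nrm (represents_dom PW PH (@WT 0%N _) xy)) _.
rewrite nrm_realZ //; apply: le_trans (ler_wpM2l d0 (DE ord0 n y)) _.
rewrite le_eqVlt; apply/orP; left; apply/eqP.
rewrite /d big_ord_recl big_split /= prodr_const card_ord.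
by rewrite [(s ^+ m.+1) ^+ n]exprAC [_ ^+ m.+1]exprS; ring.
Qed.

End HadamardPower.

(** * Comparison of f(H) with f(P) *)

Section SpectralRadiusMonotone.
Variables (R : realType) (J : index_set) (L : banach_seq_space R J).
Hypothesis L_normalized : normalized_bss L.

Lemma power_series_spectral_radius_le (i0 : J) (P H : {linear L -> L}) (alpha : nat -> R) :
  bdd P -> dom P P -> (forall s, 0 < s -> growth P s -> growth H s) ->
  (forall j, 0 <= alpha j) -> (spectral_radius P < convergence_radius alpha)%E ->
  (spectral_radius (power_series_op alpha H) <=
   spectral_radius (power_series_op alpha P))%E.
Proof.
move=> P_bdd PP PH alpha0 rho_lt.
have [r [r0 Pr Pg]] := positive_growth_spectrum L_normalized i0 P_bdd PP.
have [|t rt [B sumB]] := @lt_convergence_radius _ alpha r alpha0 r0.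
  by apply: le_lt_trans rho_lt; exact: spectral_radius_ge.
have Hg s : r < s -> growth H s.
  by move=> rs; apply: PH; [exact: le_lt_trans rs | exact: Pg].
have t0 : 0 <= t by lra.
have [FP [FP_lim /power_series_opE ->]] := power_series_exists alpha0 t0 (Pg _ rt) sumB.
have [FH [FH_lim /power_series_opE ->]] := power_series_exists alpha0 t0 (Hg _ rt) sumB.
have FP_bdd : bdd FP.
  exact: growth_bdd (power_series_growth alpha0 t0 (Pg _ rt) sumB FP_lim).
have FP_dom n : dom (psum alpha P n) FP.
  apply: (dom_lim L_normalized _ (fun x => lim_to_const _)
    (fun x => lim_to_shift n (FP_lim x))) => k.
  by apply: dom_psum_le => //; rewrite leq_addl.
have FPFP : dom FP FP.
  apply: (dom_lim L_normalized _ FP_lim FP_lim) => n.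
  exact: dom_psum.
have [r' [r'0 FPr FPg]] := positive_growth_spectrum L_normalized i0 FP_bdd FPFP.
(* The partial sum p(P) is dominated by f(P), so it grows at every rate above r'. Were p(r) > r',
   then p(r) would be in the resolvent set of p(P), and r in that of P. *)
have sum_r n : \sum_(j < n) alpha j * r ^+ j <= r'.
  rewrite leNgt; apply/negP => r'_lt; apply: Pr.
  apply: (@resolvent_psum _ _ P r alpha n P_bdd).
  have [S SE] := linear_bundle (psum_linear alpha P n).
  have := FP_dom n; rewrite SE => SF.
  apply: (@resolvent_growth _ _ S ((r' + \sum_(j < n) alpha j * r ^+ j) / 2)); first lra.
    by apply: (growth_dom SF); apply: FPg; lra.
  by rewrite nrm_real ger0_norm; lra.
apply: le_trans (spectral_radius_ge r'0 FPr).
apply: spectral_radius_le => // s rs.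
have B0 : 0 <= B by have := sumB 0%N; rewrite big_ord0.
(* As r itself need not be a rate of [H], the rate used is u = (1 - c) r + c t > r. By convexity
   f(u) <= (1 - c) f(r) + c f(t) <= r' + c B, and this is at most s by the choice of c; B + 1 avoids
   a zero denominator. *)
pose c := Num.min 1 ((s - r') / (B + 1)).
have c0 : 0 < c by rewrite lt_min ltr01 divr_gt0 //; lra.
have c1 : c <= 1 by rewrite ge_min lexx.
have cB : c * (B + 1) <= s - r' by rewrite -ler_pdivlMr ?ge_min ?lexx ?orbT //; lra.
have ru : r < (1 - c) * r + c * t by nra.
apply: (power_series_growth alpha0 _ (Hg _ ru) _ FH_lim); first lra.
move=> n; apply: (@le_trans _ _ ((1 - c) * r' + c * B)); last by nra.
apply: (@le_trans _ _ ((1 - c) * (\sum_(j < n) alpha j * r ^+ j) +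
  c * (\sum_(j < n) alpha j * t ^+ j))).
  rewrite !mulr_sumr -big_split /=; apply: ler_sum => j _.
  rewrite ![_ * (alpha j * _)]mulrCA -mulrDr ler_wpM2l //.
  by apply: expr_convex; lra.
by rewrite lerD // ler_wpM2l //; lra.
Qed.

End SpectralRadiusMonotone.

Theorem theorem3p14 (R : realType) (J : index_set) (L : banach_seq_space R J)
    (L_normalized : normalized_bss L)
    (m : nat) (m_gt0 : (0 < m)%N) (A : 'I_m -> imatrix R J)
    (A_ge0 : forall k, nonneg_imx (A k))
    (A_op : forall k, defines_operator L (A k))
    (alpha : nat -> R) (alpha_ge0 : forall j, 0 <= alpha j)
    (rho_lt : (spectral_radius (imx_op L (imx_prod A))
               < convergence_radius alpha)%E) :
  (spectral_radius (power_series_op alpha (imx_op L (imx_hadamard A)))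
   <= spectral_radius (power_series_op alpha (imx_op L (imx_prod A))))%E.
Proof.
case: m m_gt0 A A_ge0 A_op rho_lt => [m_gt0|m _] A A_ge0 A_op rho_lt.
  exfalso; exact: notF m_gt0.
have i0 : J by case: (J) => [n|]; [exact: ord0 | exact: 0%N].
(* Reducing indices modulo m + 1 extends the family to a periodic sequence, which encodes the cyclic
   reading of words. *)
pose A' t := A (inZp t); pose T t := imx_op L (A' t).
have A'A (k : 'I_m.+1) : A' k = A k by rewrite /A' valZpK.
have A'0 t : nonneg_imx (A' t) by exact: A_ge0.
have A'T t : represents (A' t) (T t) by apply: defines_operator_represents; exact: A_op.
have A'm t : A' (t + m.+1)%N = A' t.
  by congr (A _); apply: val_inj; rewrite /= modnDr.
have Tm t : T (t + m.+1)%N = T t by rewrite /T A'm.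
have prodE : imx_prod A = word_mx A' 0 m.+1.
  by rewrite -big_imulmx big_mkord; apply: eq_bigr => k _; rewrite A'A.
have hadamardE : imx_hadamard A = cyclic_hadamard m A'.
  by apply/funext => i; apply/funext => j; apply: eq_bigr => k _; rewrite A'A.
have [W0 WP] := word_mx_represents L_normalized A'0 A'T 0 m.+1.
have /defines_operator_represents HH : defines_operator L (cyclic_hadamard m A').
  exact: hadamard_defines_operator A'T.
have [P PE] := represents_linear WP; have [H HE] := represents_linear HH.
move: rho_lt; rewrite hadamardE prodE (imx_opE WP) PE HE => rho_lt.
rewrite PE in WP; rewrite HE in HH.
apply: power_series_spectral_radius_le rho_lt => //.
- exact: (represents_bdd L_normalized W0 WP).
- exact: (represents_positive W0 WP).
- move=> s s0; rewrite -PE; exact: (hadamard_growth L_normalized A'0 A'm Tm A'T HH).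
Qed.
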